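(* Let $d\in\mathbb{N}$, let $r$ be a fixed non-negative integer and let $1\le p<\infty$. There is a constant $C_{r,p}$, depending on $r$ and $p$ (but not on $f$ or $n$), such that for every $f\in L^p(Q_d)$ and all $n\in\mathbb{N}$ with $n>2r$, $$\left\|K_{n,r}^{d}(f)-f\right\|_p\le c_2\,C_{r,p}\,\omega_1\left(f;\frac{1}{\sqrt[2d]{n+1}}\right)_p ,$$ where $\omega_1(f;\cdot)_p$ is the first order multivariate $L^p$-modulus of smoothness of $f$ and $c_2$ is the positive constant (independent of $f$ and $n$) in the equivalence between $\omega_1(f;\cdot)_p$ and the $K$-functional $K_{1,p}(f;\cdot)$.
   Context: Notation: $Q_d:=[0,1]^d$; $L^p(Q_d)$ is the space of real-valued $p$-integrable functions on $Q_d$ (Lebesgue measure) with its standard norm $\|\cdot\|_p$; $\|\mathbf{x}\|_\infty=\max_{1\le i\le d}|x_i|$ on $\mathbb{R}^d$. Modulus of smoothness: for $f\in L^p(Q_d)$ and $\delta>0$, $$\omega_1(f;\delta)_p=\sup_{0<\|\mathbf{h}\|_\infty\le\delta}\left(\int |f(\mathbf{x}+\mathbf{h})-f(\mathbf{x})|^p\,d\mathbf{x}\right)^{1/p},$$ where $\mathbf{h}\in\mathbb{R}^d$ and the integral is over those $\mathbf{x}\in Q_d$ with $\mathbf{x}+\mathbf{h}\in Q_d$. $K$-functional: $W_1^p(Q_d)$ is the Sobolev space of $g\in L^p(Q_d)$ whose distributional derivatives $D^{\boldsymbol{\alpha}}g$ with $|\boldsymbol{\alpha}|\le1$ belong to $L^p(Q_d)$,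 with seminorm $|g|_{W_1^p}=\sum_{|\boldsymbol{\alpha}|=1}\|D^{\boldsymbol{\alpha}}g\|_p$, and $K_{1,p}(f;t)=\inf\{\|f-g\|_p+t|g|_{W_1^p}: g\in W_1^p(Q_d)\}$ for $t>0$. It is known that there are positive constants $c_1,c_2$ with $c_1K_{1,p}(f;t)\le\omega_1(f;t)_p\le c_2K_{1,p}(f;t)$ for all $t>0$ and all $f\in L^p(Q_d)$; $c_2$ in the claim is this constant. Operators: for non-negative integers $m$ and integers $k$, $p_{m,k}(x)=\binom{m}{k}x^k(1-x)^{m-k}$ if $0\le k\le m$ and $p_{m,k}(x)=0$ if $k<0$ or $k>m$, $x\in[0,1]$. For a non-negative integer $r$ and a natural number $n>2r$, Stancu's fundamental functions are, for $x\in[0,1]$ and $0\le k\le n$, $$w_{n,k,r}(x)=\begin{cases}(1-x)p_{n-r,k}(x), & 0\le k<r,\\ (1-x)p_{n-r,k}(x)+x\,p_{n-r,k-r}(x), & r\le k\le n-r,\\ x\,p_{n-r,k-r}(x), & n-r<k\le n.\end{cases}$$ For $\mathbf{k}=(k_1,\ldots,k_d)\in\{0,\ldots,n\}^d$ and $\mathbf{x}=(x_1,\ldots,x_d)\in Q_d$ put $w_{n,\mathbf{k},r}(\mathbf{x}):=\prod_{i=1}^d w_{n,k_i,r}(x_i)$. The multivariate Brass-Stancu-Kantorovich operators are defined, for $n>2r$ and $f\in L^1(Q_d)$, by $$K_{n,r}^{d}(f;\mathbf{x})=\sum_{\mathbf{k}\in\{0,\ldots,n\}^d} w_{n,\mathbf{k},r}(\mathbf{x})\int_{Q_d}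 f\left(\frac{\mathbf{k}+\mathbf{u}}{n+1}\right)d\mathbf{u},\qquad \mathbf{x}\in Q_d,$$ and $K_{n,r}^d(f)$ denotes the function $\mathbf{x}\mapsto K_{n,r}^d(f;\mathbf{x})$. *)

(* Defs.v *)
From HB Require Import structures.
From mathcomp Require Import all_boot all_order all_algebra.
From mathcomp Require Import all_classical all_reals all_analysis.

Set Implicit Arguments.
Unset Strict Implicit.
Unset Printing Implicit Defensive.

Import Order.TTheory GRing.Theory Num.Theory.
Import numFieldNormedType.Exports.

Local Open Scope classical_set_scope.
Local Open Scope ring_scope.

(* Points of R^d are row vectors: their library norm is the maximum norm. The
   sigma-algebra put on them is the one generated by the coordinates (i.e. the
   Borel one), as the library does for tuples. *)

Definition measure_rV_display : measure_display -> measure_display.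
Proof. exact. Qed.

Section measurable_rV.
Context {R : realType} (n : nat).

Let coors : 'I_n -> 'rV[R]_n -> R := fun i x => x ord0 i.

Let rV_set0 : g_sigma_preimage coors set0.
Proof. exact: sigma_algebra0. Qed.

Let rV_setC A : g_sigma_preimage coors A -> g_sigma_preimage coors (~` A).
Proof. exact: sigma_algebraC. Qed.

Let rV_bigcup (F : (set _)^nat) : (forall i, g_sigma_preimage coors (F i)) ->
  g_sigma_preimage coors (\bigcup_i (F i)).
Proof. exact: sigma_algebra_bigcup. Qed.

HB.instance Definition _ := @isMeasurable.Build
  (measure_rV_display default_measure_display) 'rV[R]_n
  (g_sigma_preimage coors) rV_set0 rV_setC rV_bigcup.

End measurable_rV.

Section measurable_coordinates.
Context {R : realType}.

Lemma measurable_coord n (i : 'I_n) :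
  measurable_fun [set: 'rV[R]_n] (fun x : 'rV[R]_n => x ord0 i : R).
Proof.
move=> _ Y mY; rewrite setTI; apply: sub_sigma_algebra => /=.
rewrite -bigcup_seq/=; exists i => /=; first by rewrite mem_index_enum.
by exists Y => //; rewrite setTI.
Qed.

Lemma measurable_fun_coordP d (T : measurableType d) n (f : T -> 'rV[R]_n) :
  (forall i, measurable_fun setT (fun t => f t ord0 i : R)) ->
  measurable_fun setT f.
Proof.
move=> mf.
suff H : g_sigma_preimage (fun i t => f t ord0 i : R) `<=` measurable.
  move: H; rewrite (_ : (fun i t => _) =
    (fun i => (fun x : 'rV[R]_n => x ord0 i) \o f))//.
  rewrite g_sigma_preimage_comp => H _ A mA.
  by apply: H; exists A.
apply: smallest_sub; first exact: sigma_algebra_measurable.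
case: n => [|n] in f mf *; first by rewrite big_ord0.
rewrite -bigcup_mkord_ord; apply: bigcup_sub => i Ii.
by move=> A [B mB <-]; exact: mf.
Qed.

Definition consv n (z : measurableTypeR R * 'rV[R]_n) : 'rV[R]_n.+1 :=
  row_mx (z.1)%:M z.2.

Definition unconsv n (v : 'rV[R]_n.+1) : measurableTypeR R * 'rV[R]_n :=
  (v ord0 ord0, @rsubmx _ 1 1 n v).

Lemma consvK n : cancel (@consv n) (@unconsv n).
Proof.
move=> [t v]; rewrite /unconsv /consv row_mxKr; congr pair.
have -> : ord0 = lshift n ord0 :> 'I_(1 + n) by exact/val_inj.
by rewrite (@row_mxEl _ 1 1 n) mxE eqxx mulr1n.
Qed.

Lemma measurable_consv n : measurable_fun setT (@consv n).
Proof.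
apply: measurable_fun_coordP => i.
rewrite -(@splitK 1 n i); case: (@fintype.split 1 n i) => j /=.
  rewrite (_ : (fun t => _) = fst); first exact: measurable_fst.
  apply/funext => -[t v]; rewrite /consv /=.
  by rewrite (@row_mxEl _ _ 1 n) mxE !ord1 eqxx mulr1n.
rewrite (_ : (fun t => _) = (fun v : 'rV[R]_n => v ord0 j) \o snd).
  exact: (measurableT_comp (measurable_coord j) measurable_snd).
by apply/funext => -[t v]; rewrite /consv /= (@row_mxEr _ _ 1 n).
Qed.

Lemma measurable_unconsv n : measurable_fun setT (@unconsv n).
Proof.
apply: measurable_fun_pair; first exact: measurable_coord.
apply: measurable_fun_coordP => i.
under eq_fun do rewrite mxE.
exact: measurable_coord.
Qed.

Definition unit_cube n : set 'rV[R]_n :=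
  [set x | forall i, 0 <= x ord0 i <= 1].

Lemma measurable_unit_cube n : measurable (@unit_cube n).
Proof.
have -> : @unit_cube n =
    \bigcap_(i in [set: 'I_n]) ((fun x : 'rV[R]_n => x ord0 i : R) @^-1` `[0, 1]).
  apply/seteqP; split => x /= H i; first by move=> _ /=; rewrite in_itv/= H.
  by have /= := H i Logic.I; rewrite in_itv.
apply: fin_bigcap_measurable => // i _.
by rewrite -[X in measurable X]setTI; apply: measurable_coord.
Qed.

HB.instance Definition _ n :=
  isMeasurableFun.Build _ _ _ _ (@consv n) (@measurable_consv n).

End measurable_coordinates.
Arguments unit_cube R n : clear implicits.
Arguments measurable_unit_cube R n : clear implicits.

Section lebesgue_cons.
Context {R : realType} (n : nat).
Variable m : {sigma_finite_measure set 'rV[R]_n -> \bar R}.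
Local Open Scope ereal_scope.

Definition lebesgue_cons : set 'rV[R]_n.+1 -> \bar R :=
  pushforward (@lebesgue_measure R \x m) (@consv R n).

Let lebesgue_cons0 : lebesgue_cons set0 = 0.
Proof. exact: measure0. Qed.

Let lebesgue_cons_ge0 A : 0 <= lebesgue_cons A.
Proof. exact: measure_ge0. Qed.

Let lebesgue_cons_sigma_additive : semi_sigma_additive lebesgue_cons.
Proof. exact: measure_semi_sigma_additive. Qed.

HB.instance Definition _ := isMeasure.Build _ _ _ lebesgue_cons
  lebesgue_cons0 lebesgue_cons_ge0 lebesgue_cons_sigma_additive.

Let lebesgue_cons_sigma_finite : sigma_finite setT lebesgue_cons.
Proof.
have /sigma_finiteP[F [TF ndF Foo]] := sigma_finiteT (@lebesgue_measure R).
have /sigma_finiteP[G [TG ndG Goo]] := sigma_finiteT m.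
exists (fun k => @unconsv R n @^-1` (F k `*` G k)).
  rewrite -preimage_bigcup (_ : \bigcup_k _ = setT) ?preimage_setT//.
  apply/seteqP; split => // -[x y] _.
  have [i _ Fx] : (\bigcup_k F k) x by rewrite -TF.
  have [j _ Gy] : (\bigcup_k G k) y by rewrite -TG.
  exists (maxn i j) => //; split.
  - by move: x Fx; exact/subsetPset/ndF/leq_maxl.
  - by move: y Gy; exact/subsetPset/ndG/leq_maxr.
move=> k; have [mF Fk] := Foo k; have [mG Gk] := Goo k; split.
  rewrite -[X in measurable X]setTI; apply: measurable_unconsv => //.
  exact: measurableX.
rewrite /lebesgue_cons /pushforward -comp_preimage.
rewrite (_ : _ \o _ = id); last by apply/funext => z; exact: consvK.
by rewrite preimage_id product_measure1E// lte_mul_pinfty// ge0_fin_numE.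
Qed.

HB.instance Definition _ := Measure_isSigmaFinite.Build _ _ _ lebesgue_cons
  lebesgue_cons_sigma_finite.

End lebesgue_cons.

Fixpoint lebesgue_rV {R : realType} (n : nat) :
    {sigma_finite_measure set 'rV[R]_n -> \bar R} :=
  match n with
  | 0 => \d_(0 : 'rV[R]_0)
  | n.+1 => lebesgue_cons (lebesgue_rV n)
  end.

Lemma lebesgue_rV_box (R : realType) n (A : 'I_n -> set R) :
  (forall i, measurable (A i)) ->
  lebesgue_rV n [set x : 'rV[R]_n | forall i, A i (x ord0 i)] =
  (\prod_(i < n) lebesgue_measure (A i))%E.
Proof.
elim: n A => [|n IH] A mA.
  by rewrite /= diracE big_ord0 mem_set//= => -[].
rewrite big_ord_recl -IH//= /lebesgue_cons /pushforward.
rewrite (_ : _ @^-1` _ = A ord0 `*`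
  [set x : 'rV[R]_n | forall i, A (lift ord0 i) (x ord0 i)]); last first.
  apply/seteqP; split => -[t v]/=.
    move=> H; split=> [|i].
      have := H ord0; rewrite /consv/= (_ : ord0 = lshift n ord0 :> 'I_(1+n));
        last exact/val_inj.
      rewrite (@row_mxEl _ 1 1 n) mxE eqxx mulr1n.
      by rewrite (_ : lshift n ord0 = ord0)//; exact/val_inj.
    have := H (lift ord0 i).
    rewrite /consv/= (_ : lift ord0 i = rshift 1 i :> 'I_(1+n));
      last exact/val_inj.
    by rewrite (@row_mxEr _ 1 1 n).
  move=> [H1 H2] i; case: (unliftP ord0 i) => [j|] ->.
    have e : lift ord0 j = rshift 1 j :> 'I_(1+n) by exact/val_inj.
    suff -> : consv (t, v) ord0 (lift ord0 j) = v ord0 j by exact: H2.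
    by rewrite /consv/= [X in fun_of_matrix _ _ X]e (@row_mxEr _ 1 1 n).
  have e : ord0 = lshift n ord0 :> 'I_(1+n) by exact/val_inj.
  suff -> : consv (t, v) ord0 ord0 = t by [].
  rewrite /consv/= [X in fun_of_matrix _ _ X]e.
  by rewrite (@row_mxEl _ 1 1 n) mxE eqxx mulr1n.
apply: product_measure1E; first exact: mA.
rewrite (_ : [set x : 'rV[R]_n | forall i, A (lift ord0 i) (x ord0 i)] =
  \bigcap_(i in [set: 'I_n]) ((fun x : 'rV[R]_n => x ord0 i : R) @^-1` A (lift ord0 i))).
  apply: fin_bigcap_measurable => // i _.
  by rewrite -[X in measurable X]setTI; apply: measurable_coord => //.
by apply/seteqP; split => x /= H i; [move=> _; exact: H|exact: (H i Logic.I)].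
Qed.

Section modulus_and_K_functional.
Context {R : realType} (d : nat).
Implicit Types (f g phi : 'rV[R]_d -> R) (p t delta : R).

(* Elements of L^p(Q_d) are represented by Borel functions on R^d, of which only
   the values on Q_d matter. *)
Definition cube_measure : {measure set 'rV[R]_d -> \bar R} :=
  mrestr (lebesgue_rV d) (measurable_unit_cube R d).

Definition Lp_cube p : {pred 'rV[R]_d -> R} := Lfun cube_measure p%:E.

Definition Lp_norm p f : \bar R := 'N[cube_measure]_p%:E[EFin \o f]%E.

Definition modulus p f delta : \bar R :=
  ereal_sup [set ((\int[lebesgue_rV d]_(x in [set x | unit_cube R d x /\
                                                 unit_cube R d (x + h)%R])
                     (`|f (x + h) - f x| `^ p)%R%:E) `^ p^-1)%E
            | h in [set h : 'rV[R]_d | 0 < `|h| <= delta]].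

Definition partial (i : 'I_d) phi : 'rV[R]_d -> R := 'D_(delta_mx ord0 i) phi.

Definition smooth phi := forall s : seq 'I_d,
  continuous (foldr partial phi s) /\
  forall i x, derivable (foldr partial phi s) x (delta_mx ord0 i).

Definition test_function phi :=
  [/\ smooth phi,
      compact (closure [set x | phi x != 0]) &
      closure [set x | phi x != 0] `<=`
        [set x | forall i, 0 < x ord0 i < 1]].

Definition weak_partial (i : 'I_d) g h := forall phi, test_function phi ->
  \int[lebesgue_rV d]_(x in unit_cube R d) (g x * partial i phi x) =
  - \int[lebesgue_rV d]_(x in unit_cube R d) (h x * phi x).

(* [g] is in W_1^p(Q_d), and [Dg] is its distributional gradient. *)
Definition sobolev p g (Dg : 'I_d -> 'rV[R]_d -> R) :=
  [/\ g \in Lp_cube p,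
      forall i, Dg i \in Lp_cube p &
      forall i, weak_partial i g (Dg i)].

(* The infimum runs over pairs (g, Dg); this is the infimum over g, since Dg is
   determined by g almost everywhere on Q_d. *)
Definition K_functional p f t : \bar R :=
  ereal_inf [set (Lp_norm p (fun x => f x - gDg.1 x)%R +
                  t%:E * \sum_(i < d) Lp_norm p (gDg.2 i))%E
            | gDg in [set gDg | sobolev p gDg.1 gDg.2]].

Definition modulus_K_equivalence p (c1 c2 : R) :=
  [/\ 0 < c1, 0 < c2 &
      forall f t, f \in Lp_cube p -> 0 < t ->
        (c1%:E * K_functional p f t <= modulus p f t)%E /\
        (modulus p f t <= c2%:E * K_functional p f t)%E].

End modulus_and_K_functional.

Arguments modulus_K_equivalence R d : clear implicits.

Section operators.
Context {R : realType}.

(* 'C(m, k) = 0 for k > m; negative k never occur in [stancu]. *)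
Definition bernstein_basis (m k : nat) (x : R) : R :=
  'C(m, k)%:R * x ^+ k * (1 - x) ^+ (m - k).

Definition stancu (n k r : nat) (x : R) : R :=
  if (k < r)%N then (1 - x) * bernstein_basis (n - r) k x
  else if (k <= n - r)%N then
    (1 - x) * bernstein_basis (n - r) k x
      + x * bernstein_basis (n - r) (k - r) x
  else x * bernstein_basis (n - r) (k - r) x.

Definition brass_stancu_kantorovich (d n r : nat) (f : 'rV[R]_d -> R)
    (x : 'rV[R]_d) : R :=
  \sum_(k : {ffun 'I_d -> 'I_n.+1})
    (\prod_(i < d) stancu n (k i) r (x ord0 i)) *
    \int[lebesgue_rV d]_(u in unit_cube R d)
      f (n.+1%:R^-1 *: (\row_i (k i)%:R + u)).

End operators.

(* Main.v *)
Require Import Defs.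
From mathcomp Require Import all_boot all_order all_algebra.
From mathcomp Require Import all_classical all_reals all_analysis.
From mathcomp Require Import measurable_realfun ring lra zify.

(** Write [delta = (n + 1) ^ (-1 / (2 d))] and [Q] for the unit cube. The
    estimate [|K f - f|_p <= B omega (f; delta)_p] is proved directly, with [B]
    depending on [d], [r] and [p], without passing through smooth functions; the
    equivalence with the K-functional only serves to insert the constant [c2].

    The operator is an average: [K f x] is the expectation of the mean of [f]
    over a random cell of side [1 / (n + 1)], whose index has independent
    coordinates distributed according to Stancu's weights at [x]. Three facts on
    these weights are used: they sum to one, they have second moment
    [O (1 / (n + 1))] around [x] ([stancu_second_moment]), and each of them has
    integral at most [4 / (n + 1)] over the unit interval
    ([integral_stancu_le]), so that no cell is hit too often.

    Cut [Q] into a coarser grid of cells of side comparable with [delta], and let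
    [A J] be the mean of [f] over the coarse cell [J]. For [x] in [J],
    [|K f x - f x|] is at most the sum of [|f x - A J|], of the average distance
    between the mean of [f] over the random fine cell and [A] at the coarse cell
    of its lower corner, and of the average of [|A J' - A J|], where [J'] is that
    random coarse cell ([operator_pointwise]).

    All the differences of means come down to double integrals of
    [|f z - f y| ^ p] over pairs of points at distance at most [delta]. Averaging
    the definition of the modulus over all shifts of size at most [delta], which
    is Tonelli's theorem and translation invariance, bounds such double integrals
    by [(2 delta) ^ d omega ^ p] ([sum_integral_osc_le]), and Jensen's inequality
    transfers the bound to the means ([sum_integral_dist_mean_le],
    [sum_dist_mean_le]). This settles the first two terms.

    For the third term, [|A J' - A J|] is bounded by the sum of the largest
    increments [beta L] of [A] at the grid points [L] closer to [J] than [J']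
    ([dist_grid_le]). Exchanging the sums, [beta L] is weighted by the
    probability that [J'] is further from [J] than [L]. By Chebyshev's inequality
    the probability that [J'] is at distance more than [s] is
    [O (delta ^ (2 d - 2) / s ^ 2)]; a distance in the grid is [O (1 / delta)], so
    this is [O (s ^ (-2 d))] ([weight_tail]). The kernel [(1 + s) ^ (-2 d)] has
    bounded row and column sums in dimension [d], and Schur's test bounds the
    p-th power of the third term by the sum of the [beta L ^ p]
    ([grid_schur]), to which the previous estimates apply. Keeping tails of
    probabilities, instead of estimating [A J' - A J] for each distance
    separately, is what makes the second moment suffice for every [p].

    Finally, whenever some constants [e] and [e2] realise the equivalence, every
    admissible [c2] is at least [e]: indeed [e K <= omega <= c2 K] with [K]
    finite, and [K] vanishes only together with [omega]. Hence [B <= c2 (B / e)]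
    and [B / e] is the required constant. *)


Set Implicit Arguments.
Unset Strict Implicit.
Unset Printing Implicit Defensive.

Import Order.TTheory GRing.Theory Num.Theory.
Import numFieldNormedType.Exports.

Local Open Scope classical_set_scope.
Local Open Scope ring_scope.

(** * Convexity of the p-th power *)

(** Young's inequality for [u] and [m ^ (p - 1)]. Geometrically, the graph of the
    convex function [u |-> u ^ p] lies above its tangent at [m]; every use of
    convexity below is this inequality, summed or integrated. *)
Lemma powR_tangent (R : realType) (p u m : R) : 1 <= p -> 0 <= u -> 0 <= m ->
  p * m `^ (p - 1) * u <= u `^ p + (p - 1) * m `^ p.
Proof.
move=> p1 u0 m0; have p0 : 0 < p by rewrite (lt_le_trans ltr01).
have [->|pN1] := eqVneq p 1.
  by rewrite subrr powRr0 mul0r addr0 !mul1r powRr1.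
have pm1 : 0 < p - 1 by rewrite subr_gt0 lt_neqAle eq_sym pN1.
have q0 : 0 < p / (p - 1) by rewrite divr_gt0.
have pq : p^-1 + (p / (p - 1))^-1 = 1.
  by rewrite invf_div -{1}(mul1r p^-1) -mulrDl subrKC divff// gt_eqF.
have := @conjugate_powR R u (m `^ (p - 1)) p (p / (p - 1))
  u0 (powR_ge0 _ _) p0 q0 pq.
rewrite -powRrM mulrCA divff ?gt_eqF// mulr1 invf_div => H.
rewrite -mulrA (mulrC (_ `^ _)) -(ler_pM2l (x := p^-1)) ?invr_gt0//.
rewrite mulKf ?gt_eqF//; apply: le_trans H _.
by rewrite mulrDr (mulrC p^-1) lerD2l mulrA (mulrC _ (m `^ p)) (mulrC p^-1).
Qed.

(** The tangent inequality at the weighted mean, multiplied by the weights and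
    summed. *)
Lemma weighted_jensen (R : realType) (I : finType) (w c : I -> R) (S p : R) :
  1 <= p -> 0 < S -> (forall i, 0 <= w i) -> (forall i, 0 <= c i) ->
  \sum_i w i <= S ->
  (\sum_i w i * c i) `^ p <= S `^ (p - 1) * \sum_i w i * c i `^ p.
Proof.
move=> p1 S0 w0 c0 wS; have p0 : 0 < p by rewrite (lt_le_trans ltr01).
set s := \sum_i w i * c i.
have s0 : 0 <= s by apply: sumr_ge0 => i _; rewrite mulr_ge0.
pose m := s / S; have m0 : 0 <= m by rewrite divr_ge0// ltW.
have sE : s = S * m by rewrite /m mulrCA divff ?gt_eqF// mulr1.
have mp : m `^ p = m * m `^ (p - 1).
  have [->|mN0] := eqVneq m 0; first by rewrite powR0 ?gt_eqF// mul0r.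
  by rewrite -{2}(powRr1 m0) -powRD ?mN0 ?implybT// subrKC.
have H : S * m `^ p <= \sum_i w i * c i `^ p.
  have : \sum_i w i * (p * m `^ (p - 1) * c i - (p - 1) * m `^ p)
         <= \sum_i w i * c i `^ p.
    apply: ler_sum => i _; apply: ler_wpM2l => //.
    by rewrite lerBlDr powR_tangent.
  apply: le_trans.
  under eq_bigr do rewrite mulrBr mulrCA.
  rewrite sumrB -mulr_sumr -/s -mulr_suml sE mp.
  have t0 : 0 <= (p - 1) * (m * m `^ (p - 1)).
    by rewrite mulr_ge0 ?subr_ge0// mulr_ge0 ?powR_ge0.
  have := ler_wpM2r t0 wS; nra.
have -> : s `^ p = S `^ (p - 1) * (S * m `^ p).
  have SS : S `^ (p - 1) * S = S `^ p.
    by rewrite -{2}(powRr1 (ltW S0)) -powRD ?subrK// gt_eqF// implybT.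
  by rewrite mulrA SS -powRM ?(ltW S0)// -sE.
by rewrite ler_wpM2l// powR_ge0.
Qed.

(** * Stancu's weights in one variable *)

(** If [a] is the law of a random variable [X] on [{0, ..., m}] and [B] is an
    independent Bernoulli variable of parameter [x], this is the law of
    [X + r B]. Both the binomial laws (with [r = 1]) and Stancu's weights arise
    in this way. *)
Definition shift_mix (R : realType) (x : R) (r : nat) (a : nat -> R)
    (k : nat) :=
  (1 - x) * a k + (r <= k)%:R * (x * a (k - r)%N).

(** This is conditioning on the value of [B]. *)
Lemma sum_shift_mix (R : realType) (x : R) (r m : nat) (a phi : nat -> R) :
  (forall k, (m < k)%N -> a k = 0) ->
  \sum_(k < (m + r).+1) shift_mix x r a k * phi k =
  (1 - x) * (\sum_(k < m.+1) a k * phi k) +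
  x * (\sum_(k < m.+1) a k * phi (k + r)%N).
Proof.
move=> am.
under eq_bigr do rewrite mulrDl.
rewrite big_split/=; congr (_ + _).
  under eq_bigr do rewrite -mulrA.
  rewrite -mulr_sumr; congr (_ * _).
  rewrite -(big_mkord xpredT (fun k => a k * phi k)).
  rewrite (@big_cat_nat _ _ _ m.+1)//= ?ltnS ?leq_addr//.
  rewrite [X in _ + X]big_nat_cond [X in _ + X]big1 ?addr0 ?big_mkord//.
  by move=> k /andP[/andP[mk _] _]; rewrite am ?mul0r.
rewrite -(big_mkord xpredT
  (fun k => (r <= k)%:R * (x * a (k - r)%N) * phi k)).
rewrite (@big_cat_nat _ _ _ r)//=; last by rewrite ltnW// ltnS leq_addl.
rewrite big_nat_cond big1 ?add0r; last first.
  by move=> k /andP[/andP[_ kr] _]; rewrite leqNgt kr !mul0r.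
rewrite -{1}(add0n r) big_addn subSn ?leq_addl// addnK big_mkord mulr_sumr.
by apply: eq_bigr => k _; rewrite leq_addl mul1r addnK mulrA.
Qed.

Lemma bernstein_basis_gt (R : realType) (m k : nat) (x : R) :
  (m < k)%N -> bernstein_basis m k x = 0.
Proof. by move=> mk; rewrite /bernstein_basis bin_small// !mul0r. Qed.

Lemma bernstein_basisS (R : realType) (m k : nat) (x : R) :
  bernstein_basis m.+1 k x = shift_mix x 1 (fun k => bernstein_basis m k x) k.
Proof.
rewrite /shift_mix /bernstein_basis; case: k => [|k].
  by rewrite !bin0 ltn0 !mul0r addr0 !expr0 !mul1r !subn0 exprS.
rewrite ltn0Sn subn1/= binS natrD mul1r subSS.
have [km|mk] := ltnP k m.
  by rewrite -(subnSK km) !exprS; ring.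
by rewrite (@bin_small m k.+1) ?ltnS// exprS; ring.
Qed.

Lemma sum_bernstein_basis (R : realType) (m : nat) (x : R) :
  \sum_(k < m.+1) bernstein_basis m k x = 1.
Proof.
elim: m => [|m IH].
  by rewrite big_ord_recl big_ord0 /bernstein_basis/= bin0 !expr0; ring.
have := @sum_shift_mix R x 1 m (fun k => bernstein_basis m k x) (fun=> 1)
  (@bernstein_basis_gt R m ^~ x).
rewrite addn1; under eq_bigr do rewrite -bernstein_basisS mulr1.
move=> ->; under eq_bigr do rewrite mulr1.
by rewrite IH; ring.
Qed.

(** The centre [c] is arbitrary because the induction on [m] adds a Bernoulli
    variable, which moves the centre by one. *)
Lemma bernstein_variance (R : realType) (m : nat) (x c : R) :
  \sum_(k < m.+1) bernstein_basis m k x * (k%:R - c) ^+ 2 =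
  m%:R * x * (1 - x) + (m%:R * x - c) ^+ 2.
Proof.
elim: m c => [|m IH] c.
  by rewrite big_ord_recl big_ord0 /bernstein_basis/= bin0 !expr0; ring.
have := @sum_shift_mix R x 1 m (fun k => bernstein_basis m k x)
  (fun k => (k%:R - c) ^+ 2) (@bernstein_basis_gt R m ^~ x).
rewrite addn1; under eq_bigr do rewrite -bernstein_basisS.
move=> ->; rewrite IH.
under eq_bigr => k _ do rewrite natrD -addrA -opprB.
by rewrite IH -natr1; ring.
Qed.

Lemma bernstein_basis_ge0 (R : realType) (m k : nat) (x : R) :
  0 <= x <= 1 -> 0 <= bernstein_basis m k x.
Proof.
by move=> /andP[x0 x1]; rewrite !mulr_ge0// exprn_ge0// subr_ge0.
Qed.

Lemma stancuE (R : realType) (n k r : nat) (x : R) : (2 * r < n)%N ->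
  stancu n k r x = shift_mix x r (fun k => bernstein_basis (n - r) k x) k.
Proof.
move=> rn; rewrite /stancu /shift_mix; have [kr|rk] := ltnP k r.
  by rewrite mul0r addr0.
have [kn|nk] := leqP k (n - r); rewrite mul1r//.
by rewrite (bernstein_basis_gt x nk) mulr0 add0r.
Qed.

Lemma stancu_ge0 (R : realType) (n k r : nat) (x : R) : (2 * r < n)%N ->
  0 <= x <= 1 -> 0 <= stancu n k r x.
Proof.
move=> rn x01; rewrite stancuE// /shift_mix; have /andP[x0 x1] := x01.
apply: addr_ge0; first by rewrite mulr_ge0 ?subr_ge0 ?bernstein_basis_ge0.
by apply: mulr_ge0 => //; apply: mulr_ge0 => //; exact: bernstein_basis_ge0.
Qed.

Lemma sum_stancu_mul (R : realType) (n r : nat) (x : R) (phi : nat -> R) :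
  (2 * r < n)%N ->
  \sum_(k < n.+1) stancu n k r x * phi k =
  (1 - x) * (\sum_(k < (n - r).+1) bernstein_basis (n - r) k x * phi k) +
  x * (\sum_(k < (n - r).+1) bernstein_basis (n - r) k x * phi (k + r)%N).
Proof.
move=> rn; have rn' : (r <= n)%N.
  by rewrite (leq_trans _ (ltnW rn))// leq_pmull.
rewrite -(@sum_shift_mix _ x r (n - r) (fun k => bernstein_basis (n - r) k x)).
  by rewrite subnK//; apply: eq_bigr => k _; rewrite stancuE.
by move=> k; exact: bernstein_basis_gt.
Qed.

Lemma sum_stancu (R : realType) (n r : nat) (x : R) : (2 * r < n)%N ->
  \sum_(k < n.+1) stancu n k r x = 1.
Proof.
move=> rn; have := @sum_stancu_mul R n r x (fun=> 1) rn.
under eq_bigr do rewrite mulr1.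
by move=> ->; under eq_bigr do rewrite mulr1; rewrite sum_bernstein_basis; ring.
Qed.

(** The law given by Stancu's weights has mean [n x] and variance
    [(n - r + r ^ 2) x (1 - x)], so rescaled by [n + 1] it sits within
    [O((n + 1) ^ (-1/2))] of [x]. *)
Lemma stancu_second_moment (R : realType) (n r : nat) (x : R) :
  (2 * r < n)%N -> 0 <= x <= 1 ->
  \sum_(k < n.+1) stancu n k r x * (k%:R / n.+1%:R - x) ^+ 2 <=
  (r%:R ^+ 2 + 2) / n.+1%:R.
Proof.
move=> rn /andP[x0 x1]; have rn' : (r <= n)%N.
  by rewrite (leq_trans _ (ltnW rn))// leq_pmull.
have n0 : 0 < n.+1%:R :> R by [].
have E (k : nat) : (k%:R / n.+1%:R - x) ^+ 2 =
    n.+1%:R ^- 2 * (k%:R - n.+1%:R * x) ^+ 2 :> R.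
  by rewrite -exprVn -exprMn mulrBr mulKf ?gt_eqF// mulrC.
under eq_bigr => k _ do rewrite E mulrCA.
rewrite -mulr_sumr.
have /= -> := sum_stancu_mul x (fun k => (k%:R - n.+1%:R * x) ^+ 2) rn.
rewrite bernstein_variance.
under eq_bigr => k _ do rewrite natrD -addrA -opprB.
rewrite bernstein_variance.
have aux X Y (N : R) : 0 < N -> X <= Y * N -> N ^- 2 * X <= Y / N.
  move=> N0 XY; rewrite ler_pdivlMr//.
  rewrite (_ : N ^- 2 * X * N = X / N) ?ler_pdivrMr//.
  by field; rewrite gt_eqF.
apply: aux => //.
rewrite natrB// -natr1.
have r0 : 0 <= r%:R :> R by [].
have rn1 : r%:R <= n%:R :> R by rewrite ler_nat.
set N := n%:R in rn1 *; set r' := r%:R in r0 rn1 *.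
rewrite [leLHS](_ : _ = (N - r' + r' ^+ 2) * x * (1 - x) + x ^+ 2); last first.
  by ring.
have : x * (1 - x) <= 1 by nra.
have : 0 <= x * (1 - x) by nra.
have : x ^+ 2 <= 1 by nra.
set y := x * (1 - x) => x2 y0 y1; rewrite -mulrA.
have : (N - r' + r' ^+ 2) * y <= (N - r' + r' ^+ 2) * 1.
  by apply: ler_wpM2l => //; nra.
nra.
Qed.

Section beta_integrals.
Local Open Scope ereal_scope.

(** This is a value of the Beta function. *)
Lemma integral_bernstein_basis (R : realType) (m k : nat) : (k <= m)%N ->
  \int[lebesgue_measure]_(x in `[0%R, 1%R]) (bernstein_basis m k x : R)%:E =
  (m.+1%:R^-1)%:E.
Proof.
move=> km.
have -> : \int[lebesgue_measure]_(x in `[0%R, 1%R])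
     (bernstein_basis m k x : R)%:E =
    'C(m, k)%:R%:E * (@beta_fun R k.+1 (m - k).+1)%:E.
  rewrite EFin_beta_fun integral_XMonemX_restrict setTI/=.
  rewrite -ge0_integralZl//=.
  - by apply: eq_integral => x _; rewrite /bernstein_basis -EFinM -mulrA.
  - by apply/measurable_EFinP; exact: measurable_XMonemX.
  - by move=> x x01; rewrite lee_fin XMonemX_ge0.
rewrite beta_fun_fact -EFinM subnKC//; congr EFin.
by rewrite mulrA -natrM bin_fact// factS natrM invfM mulrA mulrAC divff ?mul1r.
Qed.

Lemma measurable_bernstein_basis (R : realType) (m k : nat) (D : set R) :
  measurable_fun D (bernstein_basis m k).
Proof.
apply: measurable_funM; first exact: measurable_funM.
by apply: measurable_funX; exact: measurable_funB.
Qed.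

Lemma measurable_stancu (R : realType) (n k r : nat) (D : set R) :
  (2 * r < n)%N -> measurable_fun D (stancu n k r).
Proof.
move=> rn; rewrite (_ : stancu n k r = fun x => shift_mix x r
  (fun k => bernstein_basis (n - r) k x) k); last first.
  by apply/funext => x; rewrite stancuE.
apply: measurable_funD; apply: measurable_funM => //.
- exact: measurable_funB.
- exact: measurable_bernstein_basis.
- by apply: measurable_funM => //; exact: measurable_bernstein_basis.
Qed.

Lemma integral_bernstein_basis_le (R : realType) (m k : nat) :
  \int[lebesgue_measure]_(x in `[0%R, 1%R]) (bernstein_basis m k x : R)%:E <=
  (m.+1%:R^-1)%:E.
Proof.
have [km|mk] := leqP k m; first by rewrite integral_bernstein_basis.
under eq_integral do rewrite bernstein_basis_gt//.
by rewrite integral0 lee_fin invr_ge0.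
Qed.

(** Each of the two binomial laws that are mixed contributes
    [1 / (n - r + 1)], and [n + 1 <= 2 (n - r + 1)]. *)
Lemma integral_stancu_le (R : realType) (n k r : nat) : (2 * r < n)%N ->
  \int[lebesgue_measure]_(x in `[0%R, 1%R]) (stancu n k r x : R)%:E <=
  (4 / n.+1%:R)%:E.
Proof.
move=> rn.
have b0 j x : `[0%R, 1%R]%classic x ->
    0 <= (bernstein_basis (n - r) j x : R)%:E.
  by rewrite /= in_itv/= lee_fin; exact: bernstein_basis_ge0.
have mb j : measurable_fun (`[0%R, 1%R]%classic : set R)
    (fun x => (bernstein_basis (n - r) j x)%:E).
  by apply/measurable_EFinP; exact: measurable_bernstein_basis.
apply: (@le_trans _ _ (\int[lebesgue_measure]_(x in `[0%R, 1%R])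
  ((bernstein_basis (n - r) k x : R)%:E +
   (bernstein_basis (n - r) (k - r) x : R)%:E))).
  apply: ge0_le_integral => //=.
  - by move=> x; rewrite in_itv/= lee_fin; exact: stancu_ge0.
  - by apply/measurable_EFinP; exact: measurable_stancu.
  - apply: emeasurable_funD; exact: mb.
  - move=> x x01; rewrite -EFinD lee_fin stancuE// /shift_mix.
    move: (b0 k _ x01) (b0 (k - r)%N _ x01).
    move: x01; rewrite in_itv/= !lee_fin => /andP[x0 x1] y0 z0.
    apply: lerD; first by rewrite ler_piMl// lerBlDr lerDl.
    case: (r <= k)%N; rewrite ?mul0r// mul1r ler_piMl//.
rewrite ge0_integralD//=; try first [exact: b0|exact: mb].
apply: le_trans (leeD (integral_bernstein_basis_le _ _ _)
  (integral_bernstein_basis_le _ _ _)) _.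
rewrite -EFinD lee_fin ler_pdivlMr//.
rewrite [leLHS](_ : _ = ((2 * n.+1)%:R / (n - r).+1%:R)%R); last first.
  by rewrite natrM; ring.
by rewrite ler_pdivrMr// -natrM ler_nat; lia.
Qed.

End beta_integrals.

(** * Affine changes of variables and products in R^d *)

Section affine1.
Context {R : realType} (c b : R).
Hypothesis c0 : 0 < c.
Local Open Scope ereal_scope.

Let T (x : measurableTypeR R) : measurableTypeR R := (c * x + b)%R.

Let mT : measurable_fun setT T.
Proof. by apply: measurable_funD => //; exact: measurable_funM. Qed.

Lemma lebesgue_measure_affine (A : set R) : measurable A ->
  lebesgue_measure ((fun x : measurableTypeR R => (c * x + b)%R) @^-1` A) =
  (c^-1)%:E * lebesgue_measure A.
Proof.
move=> mA.
pose mu_ : {measure set (measurableTypeR R) -> \bar R} :=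
  mscale (NngNum (ltW c0)) (pushforward (@lebesgue_measure R) T).
pose mu := mu_ mT.
have muE B : mu B = c%:E * lebesgue_measure (T @^-1` B) by [].
suff -> : lebesgue_measure A = mu A.
  by rewrite muE muleA -EFinM mulVf ?gt_eqF// mul1e.
apply: lebesgue_measure_unique => // _ [[u v] _ <-]; rewrite muE/=.
rewrite (_ : _ @^-1` _ = `](u - b) / c, (v - b) / c]%classic)%R; last first.
  apply/seteqP; split => x /=; rewrite !in_itv/= /T.
    by rewrite ltr_pdivrMr// ler_pdivlMr// ltrBlDr lerBrDr mulrC.
  by rewrite ltr_pdivrMr// ler_pdivlMr// ltrBlDr lerBrDr mulrC.
rewrite !lebesgue_measure_itv/= !lte_fin ltr_pM2r ?invr_gt0// ltrD2r.
case: ifPn => _; last by rewrite mule0.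
rewrite -!EFinB -EFinM; congr EFin.
by field; rewrite gt_eqF.
Qed.

End affine1.

Lemma measurable_affine (R : realType) (d : nat) (c : R) (w : 'rV[R]_d) :
  measurable_fun setT (fun v : 'rV[R]_d => c *: v + w).
Proof.
apply: measurable_fun_coordP => i; under eq_fun do rewrite !mxE.
apply: measurable_funD => //; apply: measurable_funM => //.
exact: measurable_coord.
Qed.

Lemma measurable_addrV (R : realType) (d : nat) :
  measurable_fun setT (fun z : 'rV[R]_d * 'rV[R]_d => z.1 + z.2).
Proof.
apply: measurable_fun_coordP => i; under eq_fun do rewrite !mxE.
apply: measurable_funD.
  exact: (measurableT_comp (measurable_coord i) measurable_fst).
exact: (measurableT_comp (measurable_coord i) measurable_snd).
Qed.

(** The rescaled image measure takes the right values on rectangles, and the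
    product measure is determined by these; hence an induction on the dimension. *)
Lemma lebesgue_rV_affine (R : realType) (d : nat) (c : R) (w : 'rV[R]_d)
    (A : set 'rV[R]_d) : 0 < c -> measurable A ->
  lebesgue_rV d ((fun v => c *: v + w) @^-1` A) =
  ((c ^- d)%:E * lebesgue_rV d A)%E.
Proof.
move=> c0; elim: d w A => [|d IH] w A mA.
  rewrite expr0 invr1 mul1e/=; congr (\d_ _ _).
  by apply/seteqP; split => v /=; rewrite [in X in X -> _]thinmx0
    [in X in _ -> X]thinmx0 // (thinmx0 v) (thinmx0 w).
pose T1 (t : measurableTypeR R) : measurableTypeR R := c * t + w ord0 ord0.
pose w' : 'rV[R]_d := @rsubmx _ 1 1 d w.
pose Td (v : 'rV[R]_d) := c *: v + w'.
pose TT (z : measurableTypeR R * 'rV[R]_d) := (T1 z.1, Td z.2).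
have mT1 : measurable_fun setT T1.
  by apply: measurable_funD => //; exact: measurable_funM.
have mTT : measurable_fun setT TT.
  apply: measurable_fun_pair; first exact: measurableT_comp.
  exact: (measurableT_comp (measurable_affine c w') measurable_snd).
have E : (fun v : 'rV[R]_d.+1 => c *: v + w) \o @consv R d = @consv R d \o TT.
  apply/funext => -[t v] /=; apply/rowP => i; rewrite /consv/= mxE [in LHS]mxE.
  rewrite -(@splitK 1 d i); case: (@fintype.split 1 d i) => j /=.
    rewrite !(@row_mxEl _ 1 1 d) !mxE !ord1 eqxx !mulr1n; congr (_ + w _ _).
    exact/val_inj.
  by rewrite !(@row_mxEr _ 1 1 d) !mxE.
have c1 : 0 <= c ^+ d.+1 by rewrite exprn_ge0// ltW.
pose m_ : {measure set (measurableTypeR R * 'rV[R]_d) -> \bar R} :=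
  mscale (NngNum c1) (pushforward (@lebesgue_measure R \x lebesgue_rV d)%E TT).
pose m := m_ mTT.
have mE B : m B = ((c ^+ d.+1)%:E *
  (@lebesgue_measure R \x lebesgue_rV d)%E (TT @^-1` B))%E by [].
have mcA : measurable (@consv R d @^-1` A).
  by rewrite -[X in measurable X]setTI; exact: measurable_consv.
have U : (@lebesgue_measure R \x lebesgue_rV d)%E (@consv R d @^-1` A) =
    m (@consv R d @^-1` A).
  apply: product_measure_unique => // B C mB mC; rewrite mE.
  rewrite (_ : TT @^-1` _ = (T1 @^-1` B) `*` (Td @^-1` C))//.
  rewrite product_measure1E//; last 2 first.
  - by rewrite -[X in measurable X]setTI; exact: mT1.
  - by rewrite -[X in measurable X]setTI; exact: measurable_affine.
  transitivity ((c ^+ d.+1)%:E * (((c^-1)%:E * lebesgue_measure B) *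
      ((c ^- d)%:E * lebesgue_rV d C)))%E.
    congr (_ * (_ * _))%E; last exact: IH.
    exact: lebesgue_measure_affine.
  rewrite muleACA muleA -!EFinM exprS.
  rewrite -invfM -exprS !muleA -EFinM mulfV ?mul1e//.
  by rewrite gt_eqF// exprn_gt0.
rewrite /= /lebesgue_cons /pushforward -comp_preimage E comp_preimage.
rewrite [X in (_ * X)%E]U mE muleA -EFinM mulVf ?mul1e// gt_eqF//.
by rewrite exprn_gt0.
Qed.

Section integrals_rV.
Local Open Scope ereal_scope.
Context {R : realType}.

Lemma ge0_integral_rV_affine (d : nat) (c : R) (w : 'rV[R]_d)
    (D : set 'rV[R]_d) (g : 'rV[R]_d -> \bar R) :
  (0 < c)%R -> measurable D -> measurable_fun D g ->
  (forall x, D x -> 0 <= g x) ->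
  \int[lebesgue_rV d]_(x in (fun v => c *: v + w)%R @^-1` D) g (c *: x + w)%R =
  (c ^- d)%:E * \int[lebesgue_rV d]_(x in D) g x.
Proof.
move=> c0 mD mg g0.
have cd : (0 <= c ^- d :> R)%R by rewrite invr_ge0 exprn_ge0// ltW.
transitivity (\int[mscale (NngNum cd) (lebesgue_rV d)]_(x in D) g x).
  rewrite -(ge0_integral_pushforward (measurable_affine c w))//=; last first.
    by move=> x /[!inE]; exact: g0.
  pose m_ : {measure set 'rV[R]_d -> \bar R} :=
    pushforward (lebesgue_rV d) (fun v : 'rV[R]_d => c *: v + w)%R.
  apply: (@eq_measure_integral _ _ _ _ _ (m_ (measurable_affine c w))).
  move=> A mA _.
  exact: lebesgue_rV_affine.
by rewrite ge0_integral_mscale.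
Qed.

Lemma ge0_integral_rVS (d : nat) (g : 'rV[R]_d.+1 -> \bar R) :
  measurable_fun setT g -> (forall x, 0 <= g x) ->
  \int[lebesgue_rV d.+1]_x g x =
  \int[lebesgue_measure]_t \int[lebesgue_rV d]_v g (consv (t, v)).
Proof.
move=> mg g0.
rewrite -(fubini_tonelli1 (g \o @consv R d)); last 2 first.
- exact: (measurableT_comp mg (@measurable_consv R d)).
- by move=> x; exact: g0.
by rewrite /= ge0_integral_pushforward//; exact: measurable_consv.
Qed.

Lemma consv0 (d : nat) t (v : 'rV[R]_d) : consv (t, v) ord0 ord0 = t.
Proof. by have := congr1 fst (consvK (t, v)). Qed.

Lemma consv_lift (d : nat) t (v : 'rV[R]_d) i :
  consv (t, v) ord0 (lift ord0 i) = v ord0 i.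
Proof.
have /(congr1 snd)/= := consvK (t, v); move=> /rowP/(_ i); rewrite mxE => <-.
by congr (consv _ _ _); exact/val_inj.
Qed.

Lemma measurable_prod_coord (d : nat) (phi : 'I_d -> R -> R) :
  (forall i, measurable_fun setT (phi i)) ->
  measurable_fun setT (fun x : 'rV[R]_d => (\prod_(i < d) phi i (x ord0 i))%R).
Proof.
move=> mphi; apply: measurable_prod => i _.
by apply: (measurableT_comp (mphi i)); exact: measurable_coord.
Qed.

Lemma ge0_integral_prod_coord (d : nat) (phi : 'I_d -> R -> R) :
  (forall i, measurable_fun setT (phi i)) -> (forall i t, 0 <= phi i t)%R ->
  \int[lebesgue_rV d]_x (\prod_(i < d) phi i (x ord0 i))%:E =
  \prod_(i < d) \int[lebesgue_measure]_t (phi i t)%:E.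
Proof.
elim: d phi => [|d IH] phi mphi phi0.
  rewrite big_ord0; under eq_integral do rewrite big_ord0.
  by rewrite /= integral_dirac// diracT mul1e.
have mp (b : 'I_d -> R -> R) : (forall i, measurable_fun setT (b i)) ->
  measurable_fun setT (fun x : 'rV[R]_d => (\prod_(i < d) b i (x ord0 i))%:E).
  by move=> mb; apply/measurable_EFinP; exact: measurable_prod_coord.
rewrite ge0_integral_rVS; last 2 first.
- by apply/measurable_EFinP; exact: measurable_prod_coord.
- by move=> x; rewrite lee_fin prodr_ge0.
rewrite big_ord_recl -IH//.
transitivity (\int[lebesgue_measure]_t ((phi ord0 t)%:E *
   \int[lebesgue_rV d]_x (\prod_(i < d) phi (lift ord0 i) (x ord0 i))%:E)).
  apply: eq_integral => t _; rewrite -ge0_integralZl//; last 3 first.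
  - exact: (mp (fun i => phi (lift ord0 i))).
  - by move=> x _; rewrite lee_fin prodr_ge0.
  - by rewrite lee_fin.
  apply: eq_integral => v _; rewrite big_ord_recl consv0 EFinM.
  by under eq_bigr do rewrite consv_lift.
rewrite ge0_integralZr//.
- by apply/measurable_EFinP; exact: mphi.
- by move=> t _; rewrite lee_fin.
- by apply: integral_ge0 => x _; rewrite lee_fin prodr_ge0.
Qed.

Lemma ge0_integral_mrestr d (T : measurableType d)
    (mu : {measure set T -> \bar R}) (D : set T) (mD : measurable D)
    (g : T -> \bar R) :
  measurable_fun setT g -> (forall x, 0 <= g x) ->
  \int[mrestr mu mD]_x g x = \int[mu]_(x in D) g x.
Proof.
move=> mg g0.
have mN := measurableC mD.
have N0 : mrestr mu mD (~` D) = 0 by rewrite /mrestr setICl measure0.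
rewrite (ge0_negligible_integral mN measurableT mg)//.
rewrite setTD setCK; apply: eq_measure_integral => A mA AD.
by rewrite /mrestr; congr (mu _); exact/setIidPl.
Qed.

End integrals_rV.

(** * Means and the modulus of smoothness *)

Lemma rV_norm_le (R : realType) (d : nat) (h : 'rV[R]_d) (delta : R) :
  0 <= delta -> (forall j, `|h ord0 j| <= delta) -> `|h| <= delta.
Proof.
move=> d0 hd; have [->|hN0] := eqVneq h 0; first by rewrite normr0.
have /mx_norm_neq0[[i j]] : mx_norm h != 0.
  by apply: contra_neq hN0 => /mx_norm_eq0.
by rewrite /= ord1 => E; rewrite [leLHS]E.
Qed.

Section modulus.
Context {R : realType} (d : nat).
Variables (p delta : R) (f : 'rV[R]_d -> R).
Hypotheses (p1 : 1 <= p) (delta0 : 0 < delta).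
Hypothesis mf : measurable_fun setT f.
Local Open Scope ereal_scope.

Let p0 : (0 < p)%R. Proof. exact: lt_le_trans p1. Qed.

(** The supremum defining the modulus leaves out the zero shift, for which the
    integrand vanishes. *)
Lemma integral_shift_le_modulus (h : 'rV[R]_d) :
  (0 < d)%N -> (`|h| <= delta)%R ->
  \int[lebesgue_rV d]_(x in [set x | unit_cube R d x /\
                                     unit_cube R d (x + h)%R])
     (`|f (x + h) - f x| `^ p)%R%:E <= modulus p f delta `^ p.
Proof.
move=> d0 hd; have [->|hN0] := eqVneq h 0%R.
  rewrite integral0_eq ?poweR_ge0// => x _.
  by rewrite addr0 subrr normr0 powR0// gt_eqF.
set I := integral _ _ _.
have I0 : 0 <= I by apply: integral_ge0 => x _; rewrite lee_fin powR_ge0.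
have H : I `^ p^-1 <= modulus p f delta.
  by apply: ereal_sup_ubound; exists h => //=; rewrite normr_gt0 hN0.
rewrite -[leLHS](poweRe1 I0) -(@mulVf _ p) ?gt_eqF// poweRrM.
have M0 : 0 <= modulus p f delta := le_trans (poweR_ge0 _ _) H.
by apply: gt0_ler_poweR; rewrite ?(ltW p0)// in_itv/= leey andbT// poweR_ge0.
Qed.

Lemma measurable_osc :
  measurable_fun setT (fun z : 'rV[R]_d * 'rV[R]_d =>
    ((`|f (z.1 + z.2) - f z.1| `^ p)%R)%:E).
Proof.
apply/measurable_EFinP.
apply: (@measurableT_comp _ _ _ _ _ _ (@powR R ^~ p)) => //.
apply: measurableT_comp => //; apply: measurable_funB.
  exact: (measurableT_comp mf (@measurable_addrV R d)).
exact: (measurableT_comp mf measurable_fst).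
Qed.

Lemma measurable_integral_osc (F : set 'rV[R]_d) : measurable F ->
  measurable_fun setT (fun y =>
    \int[lebesgue_rV d]_(z in F) (`|f z - f y| `^ p)%R%:E).
Proof.
move=> mF.
pose K := (fun w : 'rV[R]_d * 'rV[R]_d => ((`|f w.2 - f w.1| `^ p)%R)%:E) \_
  (snd @^-1` F).
have mK : measurable_fun setT K.
  apply/(measurable_restrictT _ _).1.
    by rewrite -[X in measurable X]setTI; exact: measurable_snd.
  apply/measurable_funTS/measurable_EFinP.
  apply: (@measurableT_comp _ _ _ _ _ _ (@powR R ^~ p)) => //.
  apply: measurableT_comp => //; apply: measurable_funB.
    exact: (measurableT_comp mf measurable_snd).
  exact: (measurableT_comp mf measurable_fst).
rewrite (_ : (fun y => _) = (fun y => \int[lebesgue_rV d]_z K (y, z))).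
  apply: measurable_fun_fubini_tonelli_F => // z.
  by rewrite /K patchE; case: ifPn => // _; rewrite lee_fin powR_ge0.
apply/funext => y; rewrite integral_mkcond; apply: eq_integral => z _.
by rewrite /K !patchE; congr (if _ then _ else _); apply/idP/idP; rewrite !inE.
Qed.

Lemma measurable_box (A : 'I_d -> set R) : (forall i, measurable (A i)) ->
  measurable [set x : 'rV[R]_d | forall i, A i (x ord0 i)].
Proof.
move=> mA.
rewrite (_ : [set x | _] = \bigcap_(i in [set: 'I_d])
    ((fun x : 'rV[R]_d => x ord0 i : R) @^-1` A i)).
  apply: fin_bigcap_measurable => // i _.
  by rewrite -[X in measurable X]setTI; apply: measurable_coord.
by apply/seteqP; split => x /= H i; [move=> _; exact: H|exact: (H i Logic.I)].
Qed.

(** Averaging the translation bound over all shifts of size at most [delta]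
    controls every double integral over a set of pairs at distance at most
    [delta]; the pairs coming from disjoint [E i] do not overlap. *)
Lemma sum_integral_osc_le (I : finType) (E F : I -> set 'rV[R]_d) :
  (0 < d)%N ->
  (forall i, measurable (E i)) -> (forall i, measurable (F i)) ->
  (forall i, E i `<=` unit_cube R d) -> (forall i, F i `<=` unit_cube R d) ->
  trivIset setT E ->
  (forall i y z, E i y -> F i z ->
    forall j, (`|z ord0 j - y ord0 j| <= delta)%R) ->
  \sum_(i : I) \int[lebesgue_rV d]_(y in E i)
     \int[lebesgue_rV d]_(z in F i) (`|f z - f y| `^ p)%R%:E
  <= ((2 * delta) ^+ d)%:E * modulus p f delta `^ p.
Proof.
move=> d0 mE mF EQ FQ tE EF.
pose H :=
  [set h : 'rV[R]_d | forall j, `[(- delta)%R, delta]%classic (h ord0 j)].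
have mH : measurable H.
  apply: (measurable_box (A := fun=> `[(- delta)%R, delta]%classic)) => i.
  exact: measurable_itv.
have HE : lebesgue_rV d H = ((2 * delta) ^+ d)%:E.
  rewrite /H (@lebesgue_rV_box R d (fun=> `[(- delta)%R, delta]%classic))//.
  under eq_bigr do rewrite lebesgue_measure_itv/=.
  rewrite lte_fin gtrN// -EFinD opprK -mulr2n -(mulr_natl delta).
  by rewrite prodEFin prodr_const card_ord.
(* [S] collects the pairs (point, shift) over which the modulus is averaged. *)
pose S := [set z : 'rV[R]_d * 'rV[R]_d |
  unit_cube R d z.1 /\ unit_cube R d (z.1 + z.2)%R /\ H z.2].
have mS : measurable S.
  rewrite (_ : S = (fst @^-1` unit_cube R d) `&`
      (((fun z => z.1 + z.2)%R @^-1` unit_cube R d) `&` (snd @^-1` H)))//.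
  apply: measurableI; last apply: measurableI.
  - rewrite -[X in measurable X]setTI; apply: measurable_fst => //.
    exact: measurable_unit_cube.
  - rewrite -[X in measurable X]setTI; apply: measurable_addrV => //.
    exact: measurable_unit_cube.
  - by rewrite -[X in measurable X]setTI; exact: measurable_snd.
pose o (z : 'rV[R]_d * 'rV[R]_d) := ((`|f (z.1 + z.2) - f z.1| `^ p)%R)%:E.
have o0 z : 0 <= o z by rewrite lee_fin powR_ge0.
pose G := o \_ S.
have G0 z : 0 <= G z by rewrite /G patchE; case: ifPn.
have mG : measurable_fun setT G.
  apply/(measurable_restrictT _ _).1 => //.
  exact: measurable_funTS measurable_osc.
have mGy y : measurable_fun setT (fun h => G (y, h)).
  exact: (measurableT_comp mG (measurable_pair1 y)).
pose g y := \int[lebesgue_rV d]_h G (y, h).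
have mg : measurable_fun setT g by exact: measurable_fun_fubini_tonelli_F.
have g0 y : 0 <= g y by exact: integral_ge0.
have mosc y : measurable_fun setT (fun z => ((`|f z - f y| `^ p)%R)%:E).
  apply/measurable_EFinP.
  apply: (@measurableT_comp _ _ _ _ _ _ (@powR R ^~ p)) => //.
  by apply: measurableT_comp => //; exact: measurable_funB.
have step i y : E i y ->
    \int[lebesgue_rV d]_(z in F i) (`|f z - f y| `^ p)%R%:E <= g y.
  move=> Ey.
  have := @ge0_integral_rV_affine R d 1 y (F i)
    (fun z => (`|f z - f y| `^ p)%R%:E) ltr01 (mF i).
  rewrite expr1n invr1 mul1e => <-; last 2 first.
  - exact: measurable_funTS.
  - by move=> x _; rewrite lee_fin powR_ge0.
  have mT : measurable ((fun v => 1 *: v + y)%R @^-1` F i).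
    by rewrite -[X in measurable X]setTI; exact: measurable_affine.
  apply: (@le_trans _ _ (\int[lebesgue_rV d]_(h in
      (fun v => 1 *: v + y)%R @^-1` F i) G (y, h))); last first.
    by apply: ge0_subset_integral.
  rewrite le_eqVlt; apply/orP; left; apply/eqP; apply: eq_integral => h.
  rewrite inE/= scale1r => Fh; rewrite /G patchE mem_set; last first.
    split; first exact: EQ Ey.
    split; first by rewrite addrC; exact: FQ Fh.
    move=> j; rewrite /= in_itv/= -ler_norml.
    by have := EF _ _ _ Ey Fh j; rewrite mxE addrK.
  by rewrite /o/= (addrC h).
have mosc2 i : measurable_fun (E i) (fun y =>
    \int[lebesgue_rV d]_(z in F i) (`|f z - f y| `^ p)%R%:E).
  by apply: measurable_funTS; exact: measurable_integral_osc.
apply: (@le_trans _ _ (\sum_(i : I) \int[lebesgue_rV d]_(y in E i) g y)).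
  apply: lee_sum => i _; apply: ge0_le_integral => //.
  - move=> y _; apply: integral_ge0 => z _; rewrite lee_fin powR_ge0//.
  - by apply: measurable_funTS.
  - exact: step.
rewrite -ge0_integral_bigsetU//; last 3 first.
- exact: index_enum_uniq.
- exact: sub_trivIset tE.
- exact: measurable_funTS.
apply: (@le_trans _ _ (\int[lebesgue_rV d]_y g y)).
  apply: ge0_subset_integral => //.
  by apply: bigsetU_measurable => i _; exact: mE.
rewrite /g (fubini_tonelli G)//.
rewrite -HE muleC -integral_cst// integral_mkcond.
apply: ge0_le_integral => //.
- by move=> h _; exact: integral_ge0.
- exact: measurable_fun_fubini_tonelli_G.
- by apply/(measurable_restrictT _ _).1.
move=> h _; rewrite patchE; case: ifPn => [|hH].
  rewrite inE => hH.
  have hd : (`|h| <= delta)%R.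
    apply: rV_norm_le; first exact: ltW.
    by move=> j; have := hH j; rewrite /= in_itv/= -ler_norml.
  apply: le_trans (integral_shift_le_modulus d0 hd).
  rewrite [leRHS]integral_mkcond le_eqVlt; apply/orP; left; apply/eqP.
  apply: eq_integral => y _; rewrite /G !patchE.
  congr (if _ then _ else _).
  apply/idP/idP; rewrite !inE/=; last by case.
  by move=> [? [? _]].
rewrite integral0_eq// => y _; rewrite /G patchE ifF//.
apply/negbTE; move: hH; apply: contra; rewrite !inE.
by move=> [_ []].
Qed.

End modulus.

Section means.
Context d (T : measurableType d) (R : realType).
Variable mu : {measure set T -> \bar R}.

Definition mean (E : set T) (g : T -> R) : R :=
  (fine (mu E))^-1 * \int[mu]_(x in E) g x.

Local Open Scope ereal_scope.

(** The tangent inequality at [m = |mean E g - A|], applied to [|g - A|] and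
    integrated over [E]: the integral of [|g - A|] is at least [e m]. *)
Lemma jensen_mean (E : set T) (e p A : R) (g : T -> R) :
  (1 <= p)%R -> measurable E -> (0 < e)%R -> mu E = e%:E ->
  mu.-integrable E (EFin \o g) ->
  e%:E * (`|mean E g - A| `^ p)%R%:E <=
  \int[mu]_(x in E) ((`|g x - A| `^ p)%R)%:E.
Proof.
move=> p1 mE e0 muE ig; have p0 : (0 < p)%R := lt_le_trans ltr01 p1.
set m := (`|mean E g - A|)%R; have m0 : (0 <= m)%R by exact: normr_ge0.
have mup : (m `^ p = m `^ (p - 1) * m)%R.
  have [mE0|mN0] := eqVneq m 0%R; first by rewrite mE0 powR0 ?gt_eqF// mulr0.
  by rewrite -{3}(powRr1 m0) -powRD ?mN0 ?implybT// subrK.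
have iA : mu.-integrable E (EFin \o cst A).
  apply/integrableP; split; first exact/measurable_EFinP.
  by rewrite (integral_cst mu mE `|A|%:E) muE -EFinM ltry.
have igA : mu.-integrable E (EFin \o (fun x => g x - A)%R).
  rewrite (_ : _ \o _ = (EFin \o g) \- (EFin \o cst A)); last first.
    by apply/funext => x /=; rewrite EFinB.
  exact: integrableB.
have mgA : measurable_fun E (fun x => g x - A)%R.
  by apply/measurable_EFinP; exact: measurable_int igA.
have mgA1 : measurable_fun E (fun x => (`|g x - A|)%R%:E).
  by apply/measurable_EFinP; exact: measurableT_comp.
have mgAp : measurable_fun E (fun x => ((`|g x - A| `^ p)%R)%:E).
  apply/measurable_EFinP.
  apply: (@measurableT_comp _ _ _ _ _ _ (@powR R ^~ p)) => //.
  exact: measurableT_comp.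
have em : (e * m)%:E <= \int[mu]_(x in E) (`|g x - A|)%R%:E.
  rewrite -[leRHS]fineK; last first.
    by apply: integrable_fin_num => //; exact: integrable_norm igA.
  rewrite lee_fin; apply: le_trans (le_normr_Rintegral mE igA).
  rewrite RintegralB// Rintegral_cst// muE/= /m /mean muE/= -{1}(gtr0_norm e0).
  by rewrite -normrM mulrBr mulVKf ?gt_eqF// (mulrC A).
set X := integral _ _ _.
have key : (p * m `^ (p - 1))%:E * \int[mu]_(x in E) (`|g x - A|)%R%:E <=
    X + ((p - 1) * m `^ p * e)%:E.
  rewrite -ge0_integralZl//; last first.
    by rewrite lee_fin mulr_ge0 ?powR_ge0 ?ltW.
  have -> : ((p - 1) * m `^ p * e)%:E =
      \int[mu]_(x in E) (cst ((p - 1) * m `^ p)%:E) x.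
    by rewrite integral_cst// muE EFinM.
  have c0 : (0 <= (p - 1) * m `^ p)%R by rewrite mulr_ge0 ?subr_ge0 ?powR_ge0.
  rewrite -ge0_integralD//.
  apply: ge0_le_integral => //.
  - by move=> x _; rewrite mule_ge0// lee_fin// mulr_ge0 ?powR_ge0 ?ltW.
  - exact: measurable_funeM.
  - exact: emeasurable_funD.
  - move=> x _; rewrite -EFinM -EFinD lee_fin; exact: powR_tangent.
have : (p * m `^ (p - 1))%:E * (e * m)%:E <= X + ((p - 1) * m `^ p * e)%:E.
  apply: le_trans key; apply: lee_wpmul2l em.
  by rewrite lee_fin mulr_ge0 ?powR_ge0 ?ltW.
rewrite -!EFinM (_ : (p * _ * _ = e * m `^ p + (p - 1) * m `^ p * e)%R).
  by rewrite EFinD leeD2rE.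
by rewrite mup; ring.
Qed.

End means.

Section Lp_cube.
Context {R : realType} (d : nat).
Variables (p : R) (f : 'rV[R]_d -> R).
Hypotheses (p1 : 1 <= p).
Local Open Scope ereal_scope.

Lemma lebesgue_unit_cube : lebesgue_rV d (unit_cube R d) = 1.
Proof.
rewrite (_ : unit_cube R d =
    [set x | forall i, `[0%R, 1%R]%classic (x ord0 i)]); last first.
  by apply/seteqP; split => x /= H i; have := H i; rewrite /= in_itv.
rewrite (@lebesgue_rV_box R d (fun=> `[0%R, 1%R]%classic))//.
under eq_bigr do rewrite lebesgue_measure_itv/= lte_fin ltr01 sube0.
by rewrite big1_eq.
Qed.

Lemma Lp_cube_measurable : f \in Lp_cube p -> measurable_fun setT f.
Proof. by rewrite inE => /andP[/[!inE]]. Qed.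

Lemma Lp_cube_integrable : f \in Lp_cube p ->
  (lebesgue_rV d).-integrable (unit_cube R d) (EFin \o f).
Proof.
move=> fp; have mf := Lp_cube_measurable fp.
have : f \in Lfun (@cube_measure R d) 1.
  apply: (@Lfun_subset _ _ _ _ 1 p%:E) => //.
  suff -> : @cube_measure R d [set: 'rV[R]_d] = 1 by [].
  by rewrite /cube_measure/= /mrestr setTI; exact: lebesgue_unit_cube.
rewrite inE => /andP[_]; rewrite inE/= /finite_norm Lnorm1 => H.
apply/integrableP; split; first exact/measurable_EFinP/measurable_funTS.
rewrite -(ge0_integral_mrestr _ (measurable_unit_cube R d))//.
by apply: measurableT_comp => //; exact/measurable_EFinP.
Qed.

End Lp_cube.

(** * The uniform partition of the cube *)

Section bins.
Context {R : realType}.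
Variable m : nat.
Implicit Types (t : R) (j : 'I_m.+1).

(** The truncation by [m] puts the point 1 into the last slab, so that the
    slabs, half-open except for the last one, partition the unit interval. *)
Definition bin t : 'I_m.+1 := inord (minn (Num.truncn (m.+1%:R * t)) m).

Definition slab j : set R :=
  [set` Interval (BLeft (j%:R / m.+1%:R))
                 (BSide (j < m)%N (j.+1%:R / m.+1%:R))].

Let M0 : 0 < m.+1%:R :> R. Proof. by []. Qed.

Lemma slab_subset j : slab j `<=` `[j%:R / m.+1%:R, j.+1%:R / m.+1%:R]%classic.
Proof.
by move=> t; rewrite /slab /= !in_itv/=; case: (j < m)%N => //= /andP[-> /ltW].
Qed.

Lemma in_slab t j : 0 <= t <= 1 -> slab j t <-> bin t = j.
Proof.
move=> /andP[t0 t1]; have Mt0 : 0 <= m.+1%:R * t by rewrite mulr_ge0.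
rewrite /slab /= in_itv/= ler_pdivrMr// (mulrC t).
have /andP[a b] := Num.Theory.truncn_itv Mt0.
set u := Num.truncn _ in a b *.
have -> : (bin t = j) <-> minn u m = j :> nat.
  by split=> [<-|E]; [|apply: val_inj => /=]; rewrite inordK// ltnS geq_minr.
have [jm|jm] := boolP (j < m)%N; rewrite /= ?ltr_pdivlMr// ?ler_pdivlMr//.
  rewrite (mulrC t); split=> [/andP[jt tj]|].
    have : (j < u.+1)%N by rewrite -(ltr_nat R) (le_lt_trans jt).
    have : (u < j.+1)%N by rewrite -(ltr_nat R) (le_lt_trans a).
    by lia.
  move=> uj; have -> : j = u :> nat by lia.
  by rewrite a b.
have jE : j = m :> nat by have := ltn_ord j; lia.
rewrite jE (mulrC t) ler_piMr// andbT; split=> [mt|um].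
  suff : (m < u.+1)%N by lia.
  by rewrite -(ltr_nat R) (le_lt_trans mt).
by rewrite (le_trans _ a)// ler_nat; lia.
Qed.

Lemma bin_itv t : 0 <= t <= 1 ->
  (bin t)%:R / m.+1%:R <= t <= (bin t).+1%:R / m.+1%:R.
Proof.
by move=> t01; have /(in_slab _ t01)/slab_subset : bin t = bin t by [];
  rewrite /= in_itv.
Qed.

Lemma measurable_slab j : measurable (slab j).
Proof. exact: measurable_itv. Qed.

Lemma slab_lt j : j%:R / m.+1%:R < j.+1%:R / m.+1%:R :> R.
Proof. by rewrite ltr_pM2r ?invr_gt0// ltr_nat. Qed.

Lemma slab_width j : j.+1%:R / m.+1%:R - j%:R / m.+1%:R = m.+1%:R^-1 :> R.
Proof. by rewrite -mulrBl -natr1 addrAC subrr add0r mul1r. Qed.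

Lemma lebesgue_slab j : lebesgue_measure (slab j) = (m.+1%:R^-1)%:E.
Proof.
rewrite /slab lebesgue_measure_itv/= lte_fin slab_lt -EFinB.
by rewrite slab_width.
Qed.

Lemma slab_unit j t : slab j t -> 0 <= t <= 1.
Proof.
move=> /slab_subset; rewrite /= in_itv/= => /andP[a b].
rewrite (le_trans _ a) ?divr_ge0//= (le_trans b)// ler_pdivrMr// mul1r ler_nat.
exact: ltn_ord.
Qed.

End bins.

Section cells.
Context {R : realType} (d m : nat).
Implicit Types (J : {ffun 'I_d -> 'I_m.+1}).

Definition cell J : set 'rV[R]_d := [set x | forall i, slab (J i) (x ord0 i)].

Definition cell_of (x : 'rV[R]_d) : {ffun 'I_d -> 'I_m.+1} :=
  [ffun i => bin m (x ord0 i)].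

Lemma cell_unit_cube J : cell J `<=` unit_cube R d.
Proof. by move=> x Jx i; exact: slab_unit (Jx i). Qed.

Lemma in_cell (x : 'rV[R]_d) J : unit_cube R d x -> cell J x <-> cell_of x = J.
Proof.
move=> Qx; split=> [Jx|<-]; last by move=> i; rewrite ffunE; apply/in_slab.
by apply/ffunP => i; rewrite ffunE; apply/in_slab.
Qed.

Lemma measurable_cell J : measurable (cell J).
Proof.
apply: (measurable_box (A := fun i => slab (J i))) => i.
exact: measurable_slab.
Qed.

Lemma lebesgue_cell J : lebesgue_rV d (cell J) = (m.+1%:R ^- d)%:E.
Proof.
rewrite (@lebesgue_rV_box R d (fun i => slab (J i))); last first.
  by move=> i; exact: measurable_slab.
under eq_bigr do rewrite lebesgue_slab.
by rewrite prodEFin prodr_const card_ord exprVn.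
Qed.

Lemma trivIset_cell : trivIset setT cell.
Proof.
move=> J K _ _ [x [Jx Kx]]; have Qx := cell_unit_cube Jx.
by move/(in_cell _ Qx): Jx => <-; move/(in_cell _ Qx): Kx.
Qed.

Lemma ge0_integral_cells (g : 'rV[R]_d -> \bar R) :
  measurable_fun setT g -> (forall x, unit_cube R d x -> (0 <= g x)%E) ->
  (\int[lebesgue_rV d]_(x in unit_cube R d) g x =
   \sum_J \int[lebesgue_rV d]_(x in cell J) g x)%E.
Proof.
move=> mg g0.
have QE : unit_cube R d =
    \big[setU/set0]_(J <- index_enum {ffun 'I_d -> 'I_m.+1}) cell J.
  rewrite -bigcup_seq; apply/seteqP; split => [x Qx|x [J _]].
    by exists (cell_of x); [rewrite /= mem_index_enum|apply/in_cell].
  exact: cell_unit_cube.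
rewrite QE ge0_integral_bigsetU//.
- exact: measurable_cell.
- exact: index_enum_uniq.
- exact: sub_trivIset trivIset_cell.
- exact: measurable_funTS.
- by rewrite -QE.
Qed.

Definition closed_cell J : set 'rV[R]_d :=
  [set x | forall i,
    `[(J i)%:R / m.+1%:R, (J i).+1%:R / m.+1%:R]%classic (x ord0 i)].

Lemma measurable_closed_cell J : measurable (closed_cell J).
Proof.
exact: (@measurable_box R d
  (fun i => `[(J i)%:R / m.+1%:R, (J i).+1%:R / m.+1%:R]%classic)).
Qed.

Lemma lebesgue_closed_cell J :
  lebesgue_rV d (closed_cell J) = (m.+1%:R ^- d)%:E.
Proof.
rewrite (@lebesgue_rV_box R d
  (fun i => `[(J i)%:R / m.+1%:R, (J i).+1%:R / m.+1%:R]%classic))//.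
under eq_bigr do
  rewrite lebesgue_measure_itv/= lte_fin slab_lt -EFinB slab_width.
by rewrite prodEFin prodr_const card_ord exprVn.
Qed.

(** A cell is contained in its closure and both have the same volume, so they
    differ by a negligible set. *)
Lemma ge0_integral_closed_cell J (g : 'rV[R]_d -> \bar R) :
  measurable_fun setT g -> (forall x, (0 <= g x)%E) ->
  (\int[lebesgue_rV d]_(x in closed_cell J) g x =
   \int[lebesgue_rV d]_(x in cell J) g x)%E.
Proof.
move=> mg g0.
have sub : cell J `<=` closed_cell J.
  by move=> x Jx i; exact: slab_subset (Jx i).
have mC := measurable_closed_cell J; have mc := measurable_cell J.
have mN : measurable (closed_cell J `\` cell J) by exact: measurableD.
have N0 : lebesgue_rV d (closed_cell J `\` cell J) = 0%E.
  rewrite measureD//; last by rewrite [X in (X < _)%E]lebesgue_closed_cell ltry.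
  rewrite setIidr// [X in (X - _)%E]lebesgue_closed_cell.
  by rewrite [X in (_ - X)%E]lebesgue_cell subee.
rewrite (ge0_negligible_integral mN mC _ _ N0)//; last exact: measurable_funTS.
by rewrite setDD setIidr.
Qed.

(** As [u] runs through the cube, the point [(J + u) / m.+1] sweeps the closed
    cell [J]. *)
Lemma ge0_integral_rescale J (g : 'rV[R]_d -> \bar R) :
  measurable_fun setT g -> (forall x, (0 <= g x)%E) ->
  (\int[lebesgue_rV d]_(u in unit_cube R d)
     g (m.+1%:R^-1 *: (\row_i (J i)%:R + u))%R =
   (m.+1%:R ^+ d)%:E * \int[lebesgue_rV d]_(x in cell J) g x)%E.
Proof.
move=> mg g0; rewrite -ge0_integral_closed_cell//.
have N0 : 0 < m.+1%:R^-1 :> R by [].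
have := @ge0_integral_rV_affine R d m.+1%:R^-1 (m.+1%:R^-1 *: \row_i (J i)%:R)
  (closed_cell J) g N0 (measurable_closed_cell J).
rewrite exprVn invrK => <-//; last exact: measurable_funTS.
under eq_integral do rewrite scalerDr addrC.
congr integral; apply/seteqP; split => u /= H i.
  rewrite /= in_itv/= !mxE; have /andP[a b] := H i.
  rewrite -mulrDr (mulrC m.+1%:R^-1) !ler_pM2r ?invr_gt0// lerDr a/=.
  by rewrite -natr1 addrC lerD2l.
have := H i; rewrite /= in_itv/= !mxE -mulrDr (mulrC m.+1%:R^-1).
rewrite !ler_pM2r ?invr_gt0//.
by rewrite lerDr -natr1 addrC lerD2l.
Qed.

End cells.

Section oscillation_of_means.
Context {R : realType} (d : nat).
Variables (p delta : R) (f : 'rV[R]_d -> R).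
Hypotheses (d0 : (0 < d)%N) (p1 : 1 <= p) (delta0 : 0 < delta).
Hypothesis fp : f \in Lp_cube p.
Local Open Scope ereal_scope.
Local Notation mean := (mean (lebesgue_rV d)).

Let mf : measurable_fun setT f := Lp_cube_measurable fp.

Lemma measurable_dist_powR (A : R) :
  measurable_fun setT (fun x => (`|f x - A| `^ p)%R%:E).
Proof.
apply/measurable_EFinP.
apply: (@measurableT_comp _ _ _ _ _ _ (@powR R ^~ p)) => //.
by apply: measurableT_comp => //; exact: measurable_funB.
Qed.

(** Jensen's inequality for the mean over [F i], at each point of [E i]. *)
Lemma sum_integral_dist_mean_le (I : finType) (E F : I -> set 'rV[R]_d)
    (v : R) :
  (forall i, measurable (E i)) -> (forall i, measurable (F i)) ->
  (forall i, E i `<=` unit_cube R d) -> (forall i, F i `<=` unit_cube R d) ->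
  trivIset setT E ->
  (forall i y z, E i y -> F i z ->
    forall j, (`|z ord0 j - y ord0 j| <= delta)%R) ->
  (0 < v)%R -> (forall i, lebesgue_rV d (F i) = v%:E) ->
  \sum_(i : I) \int[lebesgue_rV d]_(y in E i) (`|f y - mean (F i) f| `^ p)%R%:E
  <= (v^-1 * (2 * delta) ^+ d)%:E * modulus p f delta `^ p.
Proof.
move=> mE mF EQ FQ tE EF v0 Fv.
rewrite EFinM -muleA.
apply: (@le_trans _ _ (v^-1%:E *
  \sum_(i : I) \int[lebesgue_rV d]_(y in E i)
     \int[lebesgue_rV d]_(z in F i) (`|f z - f y| `^ p)%R%:E)); last first.
  apply: lee_wpmul2l; first by rewrite lee_fin invr_ge0 ltW.
  exact: sum_integral_osc_le.
rewrite -lee_pdivrMl ?invr_gt0// invrK.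
rewrite ge0_sume_distrr; last first.
  by move=> i _; apply: integral_ge0 => y _; rewrite lee_fin powR_ge0.
apply: lee_sum => i _; rewrite -ge0_integralZl//; last first.
- by rewrite lee_fin ltW.
- by apply: measurable_funTS; exact: measurable_dist_powR.
apply: ge0_le_integral => //.
- by move=> y _; rewrite mule_ge0 ?lee_fin ?powR_ge0 ?ltW.
- apply: measurable_funeM; apply: measurable_funTS.
  exact: measurable_dist_powR.
- by apply: measurable_funTS; exact: measurable_integral_osc.
move=> y _; rewrite distrC; apply: jensen_mean => //; first exact: Fv.
apply: (integrableS (measurable_unit_cube R d) (mF i) (FQ i)).
exact: Lp_cube_integrable p1 fp.
Qed.

(** A second use of Jensen's inequality, now for the mean over [E i]. *)
Lemma sum_dist_mean_le (I : finType) (E F : I -> set 'rV[R]_d) (e v : R) :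
  (forall i, measurable (E i)) -> (forall i, measurable (F i)) ->
  (forall i, E i `<=` unit_cube R d) -> (forall i, F i `<=` unit_cube R d) ->
  trivIset setT E ->
  (forall i y z, E i y -> F i z ->
    forall j, (`|z ord0 j - y ord0 j| <= delta)%R) ->
  (0 < e)%R -> (forall i, lebesgue_rV d (E i) = e%:E) ->
  (0 < v)%R -> (forall i, lebesgue_rV d (F i) = v%:E) ->
  (e * \sum_(i : I) `|mean (E i) f - mean (F i) f| `^ p)%R%:E
  <= (v^-1 * (2 * delta) ^+ d)%:E * modulus p f delta `^ p.
Proof.
move=> mE mF EQ FQ tE EF e0 Ee v0 Fv.
apply: le_trans (sum_integral_dist_mean_le mE mF EQ FQ tE EF v0 Fv).
rewrite mulr_sumr -sumEFin; apply: lee_sum => i _; rewrite EFinM.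
apply: jensen_mean => //; first exact: Ee.
apply: (integrableS (measurable_unit_cube R d) (mE i) (EQ i)).
exact: Lp_cube_integrable p1 fp.
Qed.

(** Jensen's inequality for the mean over the cube, after which the change of
    variables brings the integral to the cell [k]. *)
Lemma coefficient_dist_le (n : nat) (k : {ffun 'I_d -> 'I_n.+1}) (A : R) :
  (n.+1%:R ^- d)%:E * ((`|(\int[lebesgue_rV d]_(u in unit_cube R d)
      f (n.+1%:R^-1 *: (\row_i (k i)%:R + u))) - A| `^ p)%R)%:E <=
  \int[lebesgue_rV d]_(x in cell k) ((`|f x - A| `^ p)%R)%:E.
Proof.
have N0 : (0 < n.+1%:R ^- d :> R)%R by rewrite invr_gt0 exprn_gt0.
rewrite -lee_pdivlMl// invrK.
rewrite -(ge0_integral_rescale k (measurable_dist_powR A)); last first.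
  by move=> x; rewrite lee_fin powR_ge0.
have mg : measurable_fun setT (fun u : 'rV[R]_d =>
    f (n.+1%:R^-1 *: (\row_i (k i)%:R + u))%R).
  apply: measurableT_comp => //; under eq_fun do rewrite scalerDr addrC.
  exact: measurable_affine.
have mQ := measurable_unit_cube R d.
have ig : (lebesgue_rV d).-integrable (unit_cube R d)
    (EFin \o (fun u => f (n.+1%:R^-1 *: (\row_i (k i)%:R + u))%R)).
  apply/integrableP; split; first by apply/measurable_EFinP/measurable_funTS.
  rewrite (ge0_integral_rescale k (g := fun x => `|(f x)%:E|))//; last first.
    by apply: measurableT_comp => //; exact/measurable_EFinP.
  rewrite lte_mul_pinfty ?lee_fin ?exprn_ge0//.
  have /integrableP[_] := Lp_cube_integrable p1 fp.
  apply: le_lt_trans; apply: ge0_subset_integral => //.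
  - exact: measurable_cell.
  - apply: measurable_funTS; apply: measurableT_comp => //.
    exact/measurable_EFinP.
  - exact: cell_unit_cube.
have := @jensen_mean _ _ R (lebesgue_rV d) _ 1 p A _ p1 mQ ltr01
  (lebesgue_unit_cube d) ig.
by rewrite mul1e /mean [X in fine X](lebesgue_unit_cube d)/= invr1 mul1r; apply.
Qed.

End oscillation_of_means.

(** * Summation over the grid *)

Section grid.
Context {R : realType} (d m : nat).
Local Notation grid := {ffun 'I_d -> 'I_m.+1}.
Implicit Types (J K L : grid).

Definition ndist (a b : nat) : nat := (a - b) + (b - a).

Definition grid_dist J K : nat := \max_(i < d) ndist (J i) (K i).

Lemma ndist_le_grid_dist J K i : (ndist (J i) (K i) <= grid_dist J K)%N.
Proof.
exact: (@leq_bigmax_cond _ xpredT (fun i : 'I_d => ndist (J i) (K i)) i).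
Qed.

Lemma grid_dist_max J K : (grid_dist J K <= m)%N.
Proof.
apply/bigmax_leqP => i _; rewrite /ndist.
by have := ltn_ord (J i); have := ltn_ord (K i); lia.
Qed.

Lemma grid_dist_eq0 J K : (grid_dist J K == 0)%N = (J == K).
Proof.
apply/eqP/eqP => [JK|->]; last first.
  by apply: big1 => i _; rewrite /ndist subnn.
apply/ffunP => i; apply: val_inj => /=.
have := ndist_le_grid_dist J K i.
by rewrite JK /ndist; lia.
Qed.

(** Move every coordinate of [K] that differs from that of [J] by one. *)
Lemma grid_step J K : J != K ->
  exists2 K' : grid, (grid_dist K' J < grid_dist K J)%N &
                     (grid_dist K' K <= 1)%N.
Proof.
rewrite eq_sym -grid_dist_eq0 -lt0n => KJ.
pose s (a b : nat) := if (a < b)%N then a.+1 else if (b < a)%N then a.-1 else a.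
have sm i : (s (K i) (J i) < m.+1)%N.
  rewrite /s; have := ltn_ord (J i); have := ltn_ord (K i).
  by case: ifPn => [|_]; [|case: ifPn]; lia.
exists [ffun i => Ordinal (sm i)].
  rewrite -(prednK KJ) ltnS; apply/bigmax_leqP => i _; rewrite ffunE/=.
  have := ndist_le_grid_dist K J i.
  by rewrite /ndist /s; case: ltngtP => ?; lia.
apply/bigmax_leqP => i _; rewrite ffunE/= /ndist /s.
by case: ltngtP => ?; lia.
Qed.

(** Walking from [K] to [J] one step at a time in all coordinates that differ,
    the distance to [J] decreases strictly, so the increments met are among
    those at the points closer to [J] than [K], each counted once. *)
Lemma dist_grid_le (a beta : grid -> R) J K :
  (forall L, 0 <= beta L) ->
  (forall L L', (grid_dist L L' <= 1)%N -> `|a L - a L'| <= beta L) ->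
  `|a K - a J| <= \sum_(L | (grid_dist L J < grid_dist K J)%N) beta L.
Proof.
move=> beta0 abeta; have [n] := ubnP (grid_dist K J).
elim: n => // n IH in K *; rewrite ltnS => Kn.
have [<-|JK] := eqVneq J K; first by rewrite subrr normr0 sumr_ge0.
have [K' K'J K'K] := grid_step JK.
rewrite (bigD1 K')//=.
have -> : a K - a J = - (a K' - a K) + (a K' - a J).
  by rewrite opprB addrA subrK.
apply: le_trans (ler_normD _ _) _; rewrite normrN.
apply: lerD; first exact: abeta.
apply: le_trans (IH _ (leq_trans K'J Kn)) _.
rewrite [leRHS]big_mkcond [leLHS]big_mkcond/=; apply: ler_sum => L _.
case: ifPn => LK'; last by case: ifPn.
rewrite (ltn_trans LK' K'J)/=; case: eqVneq => //= E.
by rewrite E ltnn in LK'.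
Qed.

(** This dominates [(1 + grid_dist L J) ^ (-2 d)], and being a product it has
    sums that factor over the coordinates. *)
Definition grid_weight L J : R :=
  \prod_(i < d) (1 + (ndist (L i) (J i))%:R) ^- 2.

Lemma grid_weight_ge0 L J : 0 <= grid_weight L J.
Proof. by apply: prodr_ge0 => i _; rewrite invr_ge0 exprn_ge0. Qed.

Lemma grid_weightC L J : grid_weight L J = grid_weight J L.
Proof. by apply: eq_bigr => i _; rewrite /ndist addnC. Qed.

Lemma grid_dist_weight L J :
  (1 + (grid_dist L J)%:R) ^- (2 * d) <= grid_weight L J.
Proof.
rewrite /grid_weight prodfV -exprVn exprVn lef_pV2; last 2 first.
- by rewrite posrE exprn_gt0// ltr_wpDr.
- by rewrite posrE prodr_gt0// => i _; rewrite exprn_gt0// ltr_wpDr.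
rewrite exprM -[X in _ <= _ ^+ X]card_ord -prodr_const.
apply: ler_prod => i _; rewrite exprn_ge0//= lerXn2r ?nnegrE//.
rewrite lerD2l ler_nat.
exact: ndist_le_grid_dist.
Qed.

Lemma sum_inv_square_le (n : nat) :
  \sum_(0 <= k < n) (1 + k%:R) ^- 2 <= 2 :> R.
Proof.
(* [1 / (x + 1) ^ 2] is at most [1 / (x * (x + 1))], which telescopes. *)
suff : \sum_(0 <= k < n.+1) (1 + k%:R) ^- 2 <= 2 - n.+1%:R^-1 :> R.
  rewrite big_nat_recr//= => H; apply: (le_trans _ (le_trans H _)).
    by rewrite lerDl invr_ge0 exprn_ge0.
  by rewrite gerBl.
elim: n => [|n IH]; first by rewrite big_nat1 addr0 expr1n invr1; lra.
rewrite big_nat_recr//=; apply: le_trans (lerD IH (lexx _)) _.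
rewrite -[n.+2%:R]natr1 [1 + _]addrC.
set x := n.+1%:R; have x0 : 0 < x :> R by [].
suff : (x + 1) ^- 2 <= x^-1 - (x + 1)^-1.
  by move: (_ ^- 2) (x^-1) ((x + 1)^-1) => u v w; lra.
rewrite [leRHS](_ : _ = (x * (x + 1))^-1); last first.
  by field; rewrite gt_eqF//= gt_eqF// addr_gt0.
rewrite lef_pV2 ?posrE ?exprn_gt0 ?mulr_gt0 ?addr_gt0//.
by rewrite expr2; nra.
Qed.

Lemma sum_grid_weight_le J : \sum_L grid_weight L J <= 4 ^+ d.
Proof.
rewrite /grid_weight.
rewrite -(bigA_distr_bigA (fun (i : 'I_d) (l : 'I_m.+1) =>
  (1 + (ndist l (J i))%:R) ^- 2 : R)).
rewrite -[X in _ <= _ ^+ X]card_ord -prodr_const; apply: ler_prod => i _.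
apply/andP; split; first by apply: sumr_ge0 => l _; rewrite invr_ge0 exprn_ge0.
move: (J i) => j.
rewrite -(big_mkord xpredT (fun l => (1 + (ndist l j)%:R) ^- 2 : R)).
have jm : (j <= m.+1)%N by rewrite ltnW.
(* The points on either side of [j] contribute at most 2 each. *)
rewrite (@big_cat_nat _ _ _ j)//= (_ : 4 = 2 + 2 :> R); last by ring.
apply: lerD; last first.
  rewrite -{1}(add0n (j : nat)) big_addn.
  apply: le_trans (sum_inv_square_le (m.+1 - j)).
  apply: ler_sum => l _; rewrite /ndist addnK (_ : j - _ = 0)%N ?addn0//.
  by lia.
rewrite big_nat_rev/= add0n.
apply: le_trans (sum_inv_square_le j).
rewrite big_nat_cond [leRHS]big_nat_cond.
apply: ler_sum => l /andP[/andP[_ lj] _].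
rewrite lef_pV2 ?posrE ?exprn_gt0// ?ltr_wpDr//.
rewrite lerXn2r ?nnegrE// lerD2l ler_nat /ndist.
by lia.
Qed.

(** Schur's test: Jensen's inequality uses the row sums of [grid_weight], the
    exchange of summations its column sums, both at most [4 ^ d]. *)
Lemma grid_schur (beta : grid -> R) (C p : R) : 1 <= p -> 0 <= C ->
  (forall L, 0 <= beta L) ->
  \sum_J (C * \sum_L grid_weight L J * beta L) `^ p <=
  (C * 4 ^+ d) `^ p * \sum_L beta L `^ p.
Proof.
move=> p1 C0 beta0; have p0 : 0 < p := lt_le_trans ltr01 p1.
have S0 : 0 < 4 ^+ d :> R by rewrite exprn_gt0.
apply: (@le_trans _ _ (\sum_J (C `^ p * ((4 ^+ d) `^ (p - 1) *
    \sum_L grid_weight L J * beta L `^ p)))).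
  apply: ler_sum => J _; rewrite powRM//; last first.
    by apply: sumr_ge0 => L _; rewrite mulr_ge0// grid_weight_ge0.
  apply: ler_wpM2l; first exact: powR_ge0.
  apply: weighted_jensen => // [L|]; first exact: grid_weight_ge0.
  exact: sum_grid_weight_le.
under eq_bigr do rewrite mulrA.
rewrite -mulr_sumr exchange_big/= (powRM _ C0 (ltW S0)) -!mulrA.
apply: ler_wpM2l; first exact: powR_ge0.
have -> : (4 ^+ d) `^ p = (4 ^+ d) `^ (p - 1) * 4 ^+ d :> R.
  by rewrite -{3}(powRr1 (ltW S0)) -powRD ?subrK// (gt_eqF S0) implybT.
rewrite -mulrA; apply: ler_wpM2l; first exact: powR_ge0.
rewrite mulr_sumr; apply: ler_sum => L _; rewrite -mulr_suml.
apply: ler_wpM2r; first exact: powR_ge0.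
by under eq_bigr do rewrite grid_weightC; exact: sum_grid_weight_le.
Qed.

(** Here [g k] is a random grid point, of law [w], whose distance to [J] has
    tails of order [s ^ (-2 d)]. In the expectation of the bound of
    [dist_grid_le], the coefficient of [beta L] is the probability that [g k] is
    further from [J] than [L]. *)
Lemma grid_tail_sum (K : finType) (w : K -> R) (g : K -> grid)
    (a beta : grid -> R) (C : R) J :
  (forall k, 0 <= w k) -> (forall L, 0 <= beta L) ->
  (forall L L', (grid_dist L L' <= 1)%N -> `|a L - a L'| <= beta L) ->
  (forall s : nat, (1 + s%:R) ^+ (2 * d) *
     \sum_(k | (s < grid_dist (g k) J)%N) w k <= C) ->
  \sum_k w k * `|a (g k) - a J| <= C * \sum_L grid_weight L J * beta L.
Proof.
move=> w0 beta0 abeta tail.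
apply: (@le_trans _ _ (\sum_k w k *
  \sum_(L | (grid_dist L J < grid_dist (g k) J)%N) beta L)).
  by apply: ler_sum => k _; apply: ler_wpM2l => //; exact: dist_grid_le.
have C0 : 0 <= C.
  by apply: le_trans (tail 0%N); rewrite addr0 expr1n mul1r sumr_ge0.
under eq_bigr do rewrite big_mkcond mulr_sumr.
rewrite exchange_big/= mulr_sumr; apply: ler_sum => L _.
have -> : \sum_k w k *
      (if (grid_dist L J < grid_dist (g k) J)%N then beta L else 0) =
    (\sum_(k | (grid_dist L J < grid_dist (g k) J)%N) w k) * beta L.
  rewrite mulr_suml [RHS]big_mkcond/=; apply: eq_bigr => k _.
  by case: ifPn; rewrite ?mulr0.
rewrite mulrA; apply: ler_wpM2r => //.
have e0 : 0 < (1 + (grid_dist L J)%:R) ^+ (2 * d) :> R.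
  by rewrite exprn_gt0// ltr_wpDr.
apply: (@le_trans _ _ (C * (1 + (grid_dist L J)%:R) ^- (2 * d))).
  by rewrite ler_pdivlMr// mulrC.
by rewrite ler_wpM2l// grid_dist_weight.
Qed.

End grid.

(** * Concentration of the weights of the operator *)

Section weights.
Context {R : realType} (d n r : nat).
Hypothesis rn : (2 * r < n)%N.
Local Notation index := {ffun 'I_d -> 'I_n.+1}.

Definition weight (k : index) (x : 'rV[R]_d) : R :=
  \prod_(i < d) stancu n (k i) r (x ord0 i).

Lemma weight_ge0 k x : unit_cube R d x -> 0 <= weight k x.
Proof. by move=> Qx; apply: prodr_ge0 => i _; exact: stancu_ge0. Qed.

(** The coordinates are independent, so the other ones integrate out to 1. *)
Lemma weight_marginal (x : 'rV[R]_d) (i : 'I_d) (phi : nat -> R) :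
  \sum_k weight k x * phi (k i) =
  \sum_(l < n.+1) stancu n l r (x ord0 i) * phi l.
Proof.
pose F (j : 'I_d) (l : 'I_n.+1) :=
  stancu n l r (x ord0 j) * (if j == i then phi l else 1).
have -> : \sum_k weight k x * phi (k i) =
    \sum_(k : index) \prod_(j < d) F j (k j).
  apply: eq_bigr => k _; rewrite /F big_split/=; congr (_ * _).
  by rewrite -big_mkcond big_pred1_eq.
rewrite -(bigA_distr_bigA F) (bigD1 i)//= [X in _ * X]big1 ?mulr1.
  by apply: eq_bigr => l _; rewrite /F eqxx.
move=> j ji; rewrite /F (negbTE ji).
by under eq_bigr do rewrite mulr1; exact: sum_stancu.
Qed.

Lemma sum_weight x : \sum_k weight k x = 1.
Proof.
rewrite /weight -(bigA_distr_bigA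
  (fun (j : 'I_d) (l : 'I_n.+1) => stancu n l r (x ord0 j))).
by apply: big1 => j _; exact: sum_stancu.
Qed.

Lemma index_unit (k : 'I_n.+1) : 0 <= (k%:R / n.+1%:R : R) <= 1.
Proof. by rewrite divr_ge0//= ler_pdivrMr// mul1r ler_nat ltnW. Qed.

(** The coarse cell of the lower corner of the fine cell [k]. *)
Definition coarse (m : nat) (k : index) : {ffun 'I_d -> 'I_m.+1} :=
  [ffun i => bin m ((k i)%:R / n.+1%:R : R)].

(** Chebyshev's inequality in each coordinate: a grid point further than [s]
    cells of side [1 / m.+1] away has probability
    [O((m.+1 / s) ^ 2 / n.+1) = O(m.+1 ^ (2 - 2 d) / s ^ 2)], which is
    [O(s ^ (-2 d))] since distances in the grid are at most [m]. *)
Lemma weight_tail (m : nat) (J : {ffun 'I_d -> 'I_m.+1}) (x : 'rV[R]_d)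
    (s : nat) :
  (0 < d)%N -> m.+1%:R ^+ (2 * d) <= 25 ^+ d * n.+1%:R :> R -> cell J x ->
  (1 + s%:R) ^+ (2 * d) * \sum_(k | (s < grid_dist (coarse m k) J)%N) weight k x
  <= 1 + d%:R * (r%:R ^+ 2 + 2) * 100 ^+ d.
Proof.
move=> d0 mn Jx; have Qx := cell_unit_cube Jx.
have V0 : 0 <= r%:R ^+ 2 + 2 :> R by rewrite addr_ge0// exprn_ge0.
have K0 : 0 <= d%:R * (r%:R ^+ 2 + 2) * 100 ^+ d :> R.
  by rewrite !mulr_ge0// exprn_ge0.
have [->|] := posnP s.
  rewrite addr0 expr1n mul1r; apply: (@le_trans _ _ 1); last by rewrite lerDl.
  rewrite -(sum_weight x) big_mkcond/=; apply: ler_sum => k _.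
  by case: ifPn => // _; exact: weight_ge0.
move=> s0; have [ms|sm] := ltnP m s.
  rewrite big1 ?mulr0 ?addr_ge0// => k /leq_trans/(_ (grid_dist_max _ _)).
  by rewrite ltnNge (ltnW ms).
set M : R := m.+1%:R; have M0 : 0 < M by [].
have sR0 : 0 < s%:R :> R by rewrite ltr0n.
pose c := (M / s%:R) ^+ 2.
have c0 : 0 <= c by rewrite exprn_ge0// divr_ge0// ltW.
pose q (i : 'I_d) (l : nat) : R := c * (l%:R / n.+1%:R - x ord0 i) ^+ 2.
have q0 i l : 0 <= q i l by rewrite mulr_ge0// sqr_ge0.
have far k : (s < grid_dist (coarse m k) J)%N -> 1 <= \sum_i q i (k i).
  move=> sk.
  have /existsP[i] : [exists i, s < ndist (coarse m k i) (J i)]%N.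
    apply: contraLR sk; rewrite negb_exists => /forallP sk.
    by rewrite -leqNgt; apply/bigmax_leqP => i _; rewrite leqNgt.
  rewrite ffunE => si; rewrite (bigD1 i)//=.
  apply: ler_wpDr; first exact: sumr_ge0.
  have := slab_subset (Jx i); rewrite /= in_itv/= => /andP[x1 x2].
  have /andP[t1 t2] := bin_itv m (index_unit (k i)).
  rewrite /q /c -exprMn.
  set t := _ / n.+1%:R in t1 t2 si *; set b := bin m t in t1 t2 si *.
  rewrite ler_pdivrMr// in t1; rewrite ler_pdivrMr// in x1.
  rewrite ler_pdivlMr// in t2; rewrite ler_pdivlMr// in x2.
  rewrite -/M in t1 t2 x1 x2.
  have su : s%:R ^+ 2 <= (t * M - x ord0 i * M) ^+ 2.
    have [bJ|Jb] : (J i + s < b \/ b + s < J i)%N.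
      by move: si; rewrite /ndist; lia.
    - have : (J i)%:R + s%:R + 1 <= b%:R :> R by rewrite -natrD natr1 ler_nat.
      rewrite -natr1 in x2 => bJR; apply: lerXn2r; rewrite ?nnegrE//.
        by move: sR0; lra.
      lra.
    - have : b%:R + s%:R + 1 <= (J i)%:R :> R by rewrite -natrD natr1 ler_nat.
      rewrite -natr1 in t2 => bJR; rewrite -[leRHS]sqrrN.
      apply: lerXn2r; rewrite ?nnegrE//; first by move: sR0; lra.
      lra.
  rewrite (_ : M / s%:R * (t - x ord0 i) = (t * M - x ord0 i * M) / s%:R).
    by rewrite expr_div_n ler_pdivlMr ?exprn_gt0// mul1r.
  by ring.
have V : \sum_(k | (s < grid_dist (coarse m k) J)%N) weight k x <=
    c * (d%:R * ((r%:R ^+ 2 + 2) / n.+1%:R)).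
  apply: (@le_trans _ _ (\sum_k weight k x * \sum_i q i (k i))).
    rewrite big_mkcond/=; apply: ler_sum => k _; case: ifPn => [sk|_].
      by rewrite ler_peMr// ?far// weight_ge0.
    by rewrite mulr_ge0 ?weight_ge0// sumr_ge0.
  under eq_bigr do rewrite mulr_sumr.
  rewrite exchange_big/=.
  have -> : c * (d%:R * ((r%:R ^+ 2 + 2) / n.+1%:R)) =
      \sum_(i < d) c * ((r%:R ^+ 2 + 2) / n.+1%:R).
    by rewrite big_const_ord iter_addr_0 -mulr_natl; ring.
  apply: ler_sum => i _; rewrite (weight_marginal x i (q i)) /q.
  under eq_bigr do rewrite mulrCA.
  by rewrite -mulr_sumr; apply: ler_wpM2l => //; exact: stancu_second_moment.
have e0 : 0 <= (1 + s%:R) ^+ (2 * d) :> R by rewrite exprn_ge0// addr_ge0.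
apply: le_trans (ler_wpM2l e0 V) _.
(* [100 = 4 * 25]: the 4 comes from [1 + s <= 2 * s], the 25 from the mesh. *)
apply: (@le_trans _ _ (d%:R * (r%:R ^+ 2 + 2) * 100 ^+ d));
  last by rewrite lerDr.
have -> : (1 + s%:R) ^+ (2 * d) * (c * (d%:R * ((r%:R ^+ 2 + 2) / n.+1%:R))) =
  d%:R * (r%:R ^+ 2 + 2) * ((1 + s%:R) ^+ (2 * d) * (c / n.+1%:R)) by ring.
apply: ler_wpM2l; first by rewrite mulr_ge0.
have s2 : (1 + s%:R) ^+ (2 * d) <= 4 ^+ d * s%:R ^+ (2 * d) :> R.
  rewrite !exprM -exprMn.
  apply: lerXn2r; rewrite ?nnegrE ?mulr_ge0 ?exprn_ge0//.
  have : 1 <= s%:R :> R by rewrite ler1n.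
  by move: (s%:R) => u u1; nra.
apply: (@le_trans _ _ (4 ^+ d * s%:R ^+ (2 * d) * (c / n.+1%:R))).
  by apply: ler_wpM2r => //; rewrite divr_ge0.
have -> : 100 = 4 * 25 :> R by ring.
rewrite exprMn -mulrA; apply: ler_wpM2l; first by rewrite exprn_ge0.
rewrite mulrA ler_pdivrMr//; apply: le_trans mn.
rewrite /c expr_div_n mulrA ler_pdivrMr ?exprn_gt0// -/M.
rewrite -(prednK d0) mulnS (exprD s%:R 2) (exprD M 2).
have sM : s%:R ^+ (2 * d.-1) <= M ^+ (2 * d.-1).
  by apply: lerXn2r; rewrite ?nnegrE// ler_nat ltnW.
have : 0 <= s%:R ^+ 2 * M ^+ 2 by rewrite mulr_ge0 ?exprn_ge0.
move=> /ler_wpM2r/(_ _ _ sM).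
move: (s%:R ^+ (2 * d.-1)) (M ^+ (2 * d.-1)) => u v uv.
have -> : s%:R ^+ 2 * u * M ^+ 2 = u * (s%:R ^+ 2 * M ^+ 2) by ring.
by have -> : M ^+ 2 * v * s%:R ^+ 2 = v * (s%:R ^+ 2 * M ^+ 2) by ring.
Qed.

End weights.

Lemma measurable_weight (R : realType) (d n r : nat)
    (k : {ffun 'I_d -> 'I_n.+1}) :
  (2 * r < n)%N -> measurable_fun setT (@weight R d n r k).
Proof.
move=> rn.
apply: (measurable_prod_coord (phi := fun i => stancu n (k i) r)) => i.
exact: measurable_stancu.
Qed.

Section integral_weight.
Local Open Scope ereal_scope.

Lemma integral_weight_le (R : realType) (d n r : nat)
    (k : {ffun 'I_d -> 'I_n.+1}) : (2 * r < n)%N ->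
  \int[lebesgue_rV d]_(x in unit_cube R d) (weight r k x)%:E <=
  ((4 ^+ d) / n.+1%:R ^+ d)%:E.
Proof.
move=> rn.
pose phi (i : 'I_d) : R -> R := stancu n (k i) r \_ `[0%R, 1%R].
have mphi i : measurable_fun setT (phi i).
  by apply/(measurable_restrictT _ _).1 => //; exact: measurable_stancu.
have phi0 i t : (0 <= phi i t)%R.
  rewrite /phi patchE; case: ifPn => //; rewrite inE/= in_itv/=.
  exact: stancu_ge0.
have -> : \int[lebesgue_rV d]_(x in unit_cube R d) (weight r k x)%:E =
    \int[lebesgue_rV d]_x (\prod_(i < d) phi i (x ord0 i))%:E.
  rewrite integral_mkcond; apply: eq_integral => x _; rewrite patchE.
  case: ifPn => [|xQ].
    rewrite inE => Qx; congr EFin; apply: eq_bigr => i _.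
    by rewrite /phi patchE mem_set//= in_itv; exact: Qx.
  have /existsNP[i xi] : ~ unit_cube R d x by move=> H; rewrite mem_set in xQ.
  by rewrite (bigD1 i)//= {1}/phi patchE memNset ?mul0r//=.
rewrite (ge0_integral_prod_coord mphi phi0).
have -> : ((4 ^+ d) / n.+1%:R ^+ d)%:E = \prod_(i < d) (4 / n.+1%:R : R)%:E.
  by rewrite prodEFin prodr_const card_ord expr_div_n.
have I0 i : 0 <= \int[lebesgue_measure]_t (phi i t)%:E.
  by apply: integral_ge0 => t _; rewrite lee_fin.
have I1 i : \int[lebesgue_measure]_t (phi i t)%:E <= (4 / n.+1%:R)%:E.
  apply: le_trans (@integral_stancu_le R n (k i) r rn).
  rewrite le_eqVlt; apply/orP; left; apply/eqP; rewrite [RHS]integral_mkcond.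
  apply: eq_integral => t _.
  by rewrite /phi !patchE; case: ifPn.
have /andP[] : (0 <= \prod_(i < d) \int[lebesgue_measure]_t (phi i t)%:E) &&
    (\prod_(i < d) \int[lebesgue_measure]_t (phi i t)%:E <=
     \prod_(i < d) (4 / n.+1%:R : R)%:E) => //.
elim/big_rec2: _ => [|i x y _ /andP[y0 yx]]; first by rewrite lee01 lexx.
by rewrite mule_ge0//= lee_pmul.
Qed.

End integral_weight.

Section geometry.
Context {R : realType} (d : nat).

Lemma cell_itv (m : nat) (J : {ffun 'I_d -> 'I_m.+1}) (x : 'rV[R]_d) i :
  cell J x -> (J i)%:R <= m.+1%:R * x ord0 i <= (J i).+1%:R.
Proof.
move=> Jx; have := slab_subset (Jx i).
by rewrite /= in_itv/= ler_pdivrMr// ler_pdivlMr// (mulrC m.+1%:R).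
Qed.

Lemma cell_neighbour_dist (m : nat) (J K : {ffun 'I_d -> 'I_m.+1})
    (y z : 'rV[R]_d) i :
  (grid_dist J K <= 1)%N -> cell J y -> cell K z ->
  `|z ord0 i - y ord0 i| <= 2 / m.+1%:R.
Proof.
move=> JK /(cell_itv i)/andP[y1 y2] /(cell_itv i)/andP[z1 z2].
have M0 : 0 < m.+1%:R :> R by [].
have := leq_trans (ndist_le_grid_dist J K i) JK; rewrite /ndist => JKi.
have a1 : (J i)%:R <= (K i)%:R + 1 :> R by rewrite natr1 ler_nat; lia.
have a2 : (K i)%:R <= (J i)%:R + 1 :> R by rewrite natr1 ler_nat; lia.
rewrite -natr1 in y2; rewrite -natr1 in z2.
rewrite ler_pdivlMr// mulrC -{1}(gtr0_norm M0) -normrM mulrBr ler_norml.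
by apply/andP; split; lra.
Qed.

Lemma coarse_cell_dist (n m : nat) (k : {ffun 'I_d -> 'I_n.+1})
    (y z : 'rV[R]_d) i :
  cell k y -> cell (@coarse R d n m k) z ->
  `|z ord0 i - y ord0 i| <= n.+1%:R^-1 + m.+1%:R^-1.
Proof.
move=> ky cz; have := slab_subset (ky i); rewrite /= in_itv/= => /andP[y1 y2].
have := slab_subset (cz i); rewrite /= in_itv/= => /andP[z1 z2].
have := bin_itv m (index_unit (R := R) (k i)); rewrite ffunE in z1 z2 *.
set t := (k i)%:R / _ in y1 y2 z1 z2 *.
have w1 := @slab_width R m (bin m t); have w2 := @slab_width R n (k i).
move=> /andP[t1 t2].
have aux (t' a b c u v Y Z : R) : t' <= Y -> Y <= c -> a <= Z -> Z <= b ->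
    a <= t' -> t' <= b -> b - a = u -> c - t' = v -> `|Z - Y| <= v + u.
  by move=> *; rewrite ler_norml; apply/andP; split; lra.
exact: aux y1 y2 z1 z2 t1 t2 w1 w2.
Qed.

(** Coarse cells have side at most [delta / 4], so two neighbouring ones lie
    within [delta]; fine cells have side at most [3 / 4 * delta], since
    [1 / n.+1] is at most [1 / 2] and at most [delta ^ 2]. Up to constants the
    coarse mesh is [delta], which gives the last two bounds. *)
Lemma scale_choice (n : nat) (delta : R) : (0 < d)%N -> (0 < n)%N ->
  0 < delta -> delta ^+ (2 * d) = n.+1%:R^-1 ->
  exists m : nat, [/\ 2 / m.+1%:R <= delta,
    n.+1%:R^-1 + m.+1%:R^-1 <= delta,
    m.+1%:R ^+ (2 * d) <= 25 ^+ d * n.+1%:R :> R &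
    (m.+1%:R * (2 * delta)) ^+ d <= 10 ^+ d :> R].
Proof.
move=> d0 n0 de0 deE.
have N0 : 0 < n.+1%:R :> R by [].
have N2 : n.+1%:R^-1 <= 1 / 2 :> R.
  by rewrite mul1r lef_pV2 ?posrE// ler_nat.
have de1 : delta <= 1.
  have : delta ^+ (2 * d) <= 1 by rewrite deE; apply: le_trans N2 _; lra.
  by rewrite expr_le1 ?muln_gt0 ?d0 ?(ltW de0).
have Nde2 : n.+1%:R^-1 <= delta ^+ 2.
  by rewrite -deE; apply: ler_wiXn2l; [exact: ltW|by []|rewrite leq_pmulr].
have Nde : n.+1%:R^-1 <= 3 / 4 * delta.
  move: N2 Nde2; move: (n.+1%:R^-1) => v N2 Nde2.
  have [le34|gt34] := leP delta (3 / 4); last by lra.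
  by apply: le_trans Nde2 _; rewrite expr2; nra.
have q0 : 0 <= 4 / delta by rewrite divr_ge0// ltW.
have /andP[] := Num.Theory.truncn_itv q0; set m := Num.truncn _.
rewrite ler_pdivlMr// ltr_pdivrMr// => m4 M4.
have M0 : 0 < m.+1%:R :> R by [].
have Mde : m.+1%:R * delta <= 5 by rewrite -natr1 mulrDl mul1r; lra.
have Minv : m.+1%:R^-1 <= delta / 4.
  by rewrite -(ler_pM2l M0) divff ?gt_eqF//; lra.
exists m; split.
- by move: Minv; move: (m.+1%:R^-1) => u; lra.
- by move: Minv Nde; move: (m.+1%:R^-1) (n.+1%:R^-1) => u v; lra.
- rewrite -ler_pdivrMr// -deE -exprMn.
  have -> : 25 = 5 ^+ 2 :> R by ring.
  rewrite -exprM; apply: lerXn2r => //; rewrite nnegrE ?mulr_ge0// ltW//.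
- apply: lerXn2r; rewrite ?nnegrE ?mulr_ge0 ?(ltW de0)//; lra.
Qed.

(** With the largest increment at [L] attained towards one neighbour [s L], its
    p-th power is controlled by a single pair of cells for each [L]. *)
Lemma furthest_neighbour (m : nat) (a : {ffun 'I_d -> 'I_m.+1} -> R) :
  exists s : {ffun 'I_d -> 'I_m.+1} -> {ffun 'I_d -> 'I_m.+1},
  forall L, (grid_dist L (s L) <= 1)%N /\
  forall L', (grid_dist L L' <= 1)%N -> `|a L - a L'| <= `|a L - a (s L)|.
Proof.
exists (fun L =>
  [arg max_(K > L | (grid_dist L K <= 1)%N) `|a L - a K|]%O) => L.
case: (@Order.TotalTheory.arg_maxP _ R _ L
  (fun K => (grid_dist L K <= 1)%N) (fun K => `|a L - a K|)) => //.
by have /eqP -> : grid_dist L L == 0%N by rewrite grid_dist_eq0.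
Qed.

End geometry.

(** * The estimate in terms of the modulus of smoothness *)

(** The bound of [weight_tail]. *)
Definition tail_constant (R : realType) (d r : nat) : R :=
  1 + d%:R * (r%:R ^+ 2 + 2) * 100 ^+ d.

Lemma tail_constant_ge0 (R : realType) (d r : nat) : 0 <= tail_constant R d r.
Proof.
by rewrite addr_ge0// mulr_ge0 ?exprn_ge0// mulr_ge0// addr_ge0// exprn_ge0.
Qed.

(** One summand for each term of [operator_pointwise]; the common factor
    [10 ^ d] is that of [scale_choice]. *)
Definition operator_constant (R : realType) (d r : nat) (p : R) : R :=
  3 `^ (p - 1) * (10 ^+ d + 4 ^+ d * 10 ^+ d +
                  (tail_constant R d r * 4 ^+ d) `^ p * 10 ^+ d).

Lemma operator_constant_ge0 (R : realType) (d r : nat) (p : R) :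
  0 <= operator_constant d r p.
Proof.
by rewrite mulr_ge0 ?powR_ge0// !addr_ge0 ?mulr_ge0 ?exprn_ge0 ?powR_ge0.
Qed.

Section operator_bound.
Context {R : realType} (d n m r : nat).
Variables (p delta : R) (f : 'rV[R]_d -> R).
Hypotheses (d0 : (0 < d)%N) (p1 : 1 <= p) (delta0 : 0 < delta).
Hypotheses (rn : (2 * r < n)%N) (fp : f \in Lp_cube p).
Hypothesis m_near : 2 / m.+1%:R <= delta.
Hypothesis nm_near : n.+1%:R^-1 + m.+1%:R^-1 <= delta.
Hypothesis m_fine : m.+1%:R ^+ (2 * d) <= 25 ^+ d * n.+1%:R :> R.
Hypothesis m_coarse : (m.+1%:R * (2 * delta)) ^+ d <= 10 ^+ d :> R.

Local Notation mu := (lebesgue_rV d).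
Local Notation grid := {ffun 'I_d -> 'I_m.+1}.
Local Notation index := {ffun 'I_d -> 'I_n.+1}.
Local Notation Omega := (modulus p f delta `^ p)%E.

Let mf : measurable_fun setT f := Lp_cube_measurable fp.
Local Notation A := (fun L : grid => mean mu (cell L) f).
Local Notation a := (fun k : index => \int[mu]_(u in unit_cube R d)
  f (n.+1%:R^-1 *: (\row_i (k i)%:R + u))).
Local Notation g := (@coarse R d n m).
Local Notation c := (fun k : index => `|a k - A (g k)|).
Local Notation C := (tail_constant R d r).

Let M0 : 0 < m.+1%:R ^- d :> R.
Proof. by rewrite invr_gt0 exprn_gt0. Qed.

Lemma scale_le : (((m.+1%:R ^- d)^-1 * (2 * delta) ^+ d)%:E * Omega <=
  (10 ^+ d)%:E * Omega)%E.
Proof.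
apply: lee_wpmul2r; first exact: poweR_ge0.
by rewrite lee_fin invrK -exprMn.
Qed.

Lemma cell_near (J K : grid) y z : (grid_dist J K <= 1)%N ->
  cell J y -> cell K z -> forall j, `|z ord0 j - y ord0 j| <= delta.
Proof.
move=> JK Jy Kz j; apply: le_trans m_near.
exact: cell_neighbour_dist JK Jy Kz.
Qed.

Lemma sum_integral_dist_cell_mean_le :
  (\sum_J \int[mu]_(y in cell J) (`|f y - A J| `^ p)%:E <=
  (10 ^+ d)%:E * Omega)%E.
Proof.
apply: le_trans scale_le.
apply: (@sum_integral_dist_mean_le R d p delta f d0 p1 delta0 fp grid
  (@cell R d m) (@cell R d m) (m.+1%:R ^- d)) => //.
- exact: measurable_cell.
- exact: measurable_cell.
- exact: cell_unit_cube.
- exact: cell_unit_cube.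
- exact: trivIset_cell.
- move=> J y z; apply: cell_near.
  by have /eqP -> : grid_dist J J == 0%N by rewrite grid_dist_eq0.
- exact: lebesgue_cell.
Qed.

Lemma sum_dist_coefficient_le :
  ((n.+1%:R ^- d * \sum_k c k `^ p)%:E <= (10 ^+ d)%:E * Omega)%E.
Proof.
apply: le_trans scale_le.
apply: le_trans (@sum_integral_dist_mean_le R d p delta f d0 p1 delta0 fp index
  (@cell R d n) (fun k => cell (g k)) (m.+1%:R ^- d) _ _ _ _ _ _ _ _) => //.
- rewrite mulr_sumr -sumEFin; apply: lee_sum => k _; rewrite EFinM.
  exact: coefficient_dist_le.
- exact: measurable_cell.
- by move=> k; exact: measurable_cell.
- exact: cell_unit_cube.
- by move=> k; exact: cell_unit_cube.
- exact: trivIset_cell.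
- move=> k y z ky kz j; apply: le_trans nm_near.
  exact: coarse_cell_dist ky kz.
- by move=> k; exact: lebesgue_cell.
Qed.

Lemma cell_mean_increments : exists2 beta : grid -> R,
  (forall L L', (grid_dist L L' <= 1)%N -> `|A L - A L'| <= beta L) /\
  (forall L, 0 <= beta L) &
  ((m.+1%:R ^- d * \sum_L beta L `^ p)%:E <= (10 ^+ d)%:E * Omega)%E.
Proof.
have [s sP] := furthest_neighbour A.
exists (fun L => `|A L - A (s L)|).
  by split=> [L|//]; exact: (sP L).2.
apply: le_trans scale_le.
apply: (@sum_dist_mean_le R d p delta f d0 p1 delta0 fp grid
  (@cell R d m) (fun L => cell (s L)) (m.+1%:R ^- d) (m.+1%:R ^- d)) => //.
- exact: measurable_cell.
- by move=> L; exact: measurable_cell.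
- exact: cell_unit_cube.
- by move=> L; exact: cell_unit_cube.
- exact: trivIset_cell.
- by move=> L y z; apply: cell_near; exact: (sP L).1.
- exact: lebesgue_cell.
- by move=> L; exact: lebesgue_cell.
Qed.

Lemma powR_add3_le (x y z : R) : 0 <= x -> 0 <= y -> 0 <= z ->
  (x + y + z) `^ p <= 3 `^ (p - 1) * (x `^ p + y `^ p + z `^ p).
Proof.
move=> x0 y0 z0.
pose h (i : 'I_3) : R :=
  if val i is 0%N then x else if val i is 1%N then y else z.
have h0 i : 0 <= h i by case: i => -[|[|i]].
have := @weighted_jensen R _ (fun=> 1) h 3 p p1 _ _ h0.
rewrite !big_ord_recl !big_ord0 /h/= !mul1r !addr0 !addrA.
by apply => //; lra.
Qed.

(** Insert [A (g k)] and [A J] between [a k] and [f x]: the first two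
    differences are kept, the third one is bounded by [grid_tail_sum]. *)
Lemma operator_pointwise (beta : grid -> R) (J : grid) (x : 'rV[R]_d) :
  (forall L L', (grid_dist L L' <= 1)%N -> `|A L - A L'| <= beta L) ->
  (forall L, 0 <= beta L) -> cell J x ->
  `|brass_stancu_kantorovich n r f x - f x| `^ p <=
  3 `^ (p - 1) * (`|f x - A J| `^ p + \sum_k weight r k x * c k `^ p +
                  (C * \sum_L grid_weight L J * beta L) `^ p).
Proof.
move=> beta1 beta0 Jx; have Qx := cell_unit_cube Jx.
have p0 : 0 < p := lt_le_trans ltr01 p1.
have C0 := tail_constant_ge0 R d r.
have w0 k : 0 <= weight r k x := weight_ge0 rn k Qx.
have c0 k : 0 <= c k := normr_ge0 _.
have cS0 : 0 <= \sum_k weight r k x * c k.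
  by apply: sumr_ge0 => k _; rewrite mulr_ge0.
have tri : `|brass_stancu_kantorovich n r f x - f x| <=
    `|f x - A J| + \sum_k weight r k x * c k +
    \sum_k weight r k x * `|A (g k) - A J|.
  have -> : brass_stancu_kantorovich n r f x - f x =
      - (f x - A J) + \sum_k weight r k x * (a k - A (g k)) +
      \sum_k weight r k x * (A (g k) - A J).
    have -> : f x - A J = \sum_(k : index) weight r k x * (f x - A J).
      by rewrite -mulr_suml sum_weight// mul1r.
    rewrite -sumrN -!big_split/=.
    have {1}-> : f x = \sum_(k : index) weight r k x * f x.
      by rewrite -mulr_suml sum_weight// mul1r.
    rewrite /brass_stancu_kantorovich -sumrB; apply: eq_bigr => k _.
    by rewrite -/(weight r k x) -/(a k); ring.
  apply: le_trans (ler_normD _ _) _; apply: lerD.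
    apply: le_trans (ler_normD _ _) _; rewrite normrN lerD2l.
    apply: le_trans (ler_norm_sum _ _ _) _; apply: ler_sum => k _.
    by rewrite normrM ger0_norm.
  apply: le_trans (ler_norm_sum _ _ _) _; apply: ler_sum => k _.
  by rewrite normrM ger0_norm.
have far : \sum_k weight r k x * `|A (g k) - A J| <=
    C * \sum_L grid_weight L J * beta L.
  apply: (@grid_tail_sum R d m index (fun k => weight r k x) g A beta) => // s.
  exact: weight_tail.
have t0 : 0 <= C * \sum_L grid_weight L J * beta L.
  by apply: mulr_ge0 => //; apply: sumr_ge0 => L _;
    rewrite mulr_ge0// grid_weight_ge0.
apply: (@le_trans _ _ ((`|f x - A J| + \sum_k weight r k x * c k +
    C * \sum_L grid_weight L J * beta L) `^ p)).
  apply: ge0_ler_powR; rewrite ?nnegrE ?(ltW p0) ?addr_ge0//.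
  by apply: le_trans tri _; rewrite lerD2l.
apply: le_trans (powR_add3_le _ cS0 t0) _ => //.
apply: ler_wpM2l; first exact: powR_ge0.
rewrite lerD2r lerD2l.
have := @weighted_jensen R _ (fun k => weight r k x) c 1 p p1 ltr01 w0.
by rewrite powR1 mul1r sum_weight//; apply => // k; exact: normr_ge0.
Qed.

(** The pointwise bound integrated over each coarse cell. In the middle term only
    the weights depend on the point, and integrating them yields the volume of a
    fine cell up to [4 ^ d]. *)
Lemma operator_bound :
  (\int[mu]_(x in unit_cube R d)
     (`|brass_stancu_kantorovich n r f x - f x| `^ p)%:E <=
   (operator_constant d r p)%:E * Omega)%E.
Proof.
have [beta [beta1 beta0] H3'] := cell_mean_increments.
have C0 := tail_constant_ge0 R d r.
have mQ := measurable_unit_cube R d.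
set K := brass_stancu_kantorovich n r f.
pose t J := (C * \sum_L grid_weight L J * beta L) `^ p.
pose S x := \sum_k weight r k x * c k `^ p.
have cp0 k : 0 <= c k `^ p by exact: powR_ge0.
have t0 J : 0 <= t J by exact: powR_ge0.
have S0 x : unit_cube R d x -> 0 <= S x.
  by move=> Qx; apply: sumr_ge0 => k _; rewrite mulr_ge0// (weight_ge0 rn).
have mS : measurable_fun setT S.
  apply: measurable_sum => k; apply: measurable_funM => //.
  exact: measurable_weight.
have mK : measurable_fun setT (fun x => `|K x - f x| `^ p).
  apply: (@measurableT_comp _ _ _ _ _ _ (@powR R ^~ p)) => //.
  apply: measurableT_comp => //; apply: measurable_funB => //.
  apply: measurable_sum => k; apply: measurable_funM => //.
  exact: measurable_weight.
have c30 : (0 <= (3 `^ (p - 1))%:E :> \bar R)%E by rewrite lee_fin powR_ge0.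
have H2' : (\int[mu]_(x in unit_cube R d) (S x)%:E <=
    (4 ^+ d)%:E * ((10 ^+ d)%:E * Omega))%E.
  apply: (@le_trans _ _ ((4 ^+ d)%:E * (n.+1%:R ^- d * \sum_k c k `^ p)%:E)%E).
    under eq_integral do rewrite -sumEFin.
    rewrite ge0_integral_sum//; last 2 first.
    - move=> k; apply/measurable_EFinP/measurable_funTS.
      by apply: measurable_funM => //; exact: measurable_weight.
    - by move=> k x Qx; rewrite lee_fin mulr_ge0// (weight_ge0 rn).
    rewrite -EFinM mulrA mulr_sumr -sumEFin; apply: lee_sum => k _.
    under eq_integral do rewrite EFinM.
    rewrite ge0_integralZr//; last 2 first.
    - by apply/measurable_EFinP/measurable_funTS; exact: measurable_weight.
    - by move=> x Qx; rewrite lee_fin (weight_ge0 rn).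
    rewrite EFinM; apply: lee_wpmul2r; first by rewrite lee_fin.
    exact: integral_weight_le.
  apply: lee_wpmul2l; first by rewrite lee_fin exprn_ge0.
  exact: sum_dist_coefficient_le.
have H3'' : (\sum_J (m.+1%:R ^- d * t J)%:E <=
    ((C * 4 ^+ d) `^ p)%:E * ((10 ^+ d)%:E * Omega))%E.
  apply: (@le_trans _ _ (((C * 4 ^+ d) `^ p)%:E *
      (m.+1%:R ^- d * \sum_L beta L `^ p)%:E)%E).
    rewrite sumEFin -mulr_sumr -EFinM lee_fin mulrCA ler_wpM2l// ?(ltW M0)//.
    exact: grid_schur.
  by apply: lee_wpmul2l => //; rewrite lee_fin powR_ge0.
have mE (h : 'rV[R]_d -> R) (D : set 'rV[R]_d) :
    measurable_fun setT h -> measurable_fun D (fun x => (h x)%:E).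
  by move=> mh; apply/measurable_EFinP/measurable_funTS.
have mfA J : measurable_fun setT (fun x => `|f x - A J| `^ p).
  by apply/measurable_EFinP; exact: measurable_dist_powR.
have cellI J : (\int[mu]_(x in cell J) (`|K x - f x| `^ p)%:E <=
   (3 `^ (p - 1))%:E * (\int[mu]_(x in cell J) (`|f x - A J| `^ p)%:E +
     \int[mu]_(x in cell J) (S x)%:E + (m.+1%:R ^- d * t J)%:E))%E.
  have mJ : measurable (@cell R d m J) by exact: measurable_cell.
  have SJ x : cell J x -> 0 <= S x by move=> Jx; exact/S0/cell_unit_cube/Jx.
  have -> : (m.+1%:R ^- d * t J)%:E =
      (\int[mu]_(x in cell J) (cst (t J)%:E) x)%E.
    by rewrite integral_cst// [X in (_ * X)%E]lebesgue_cell mulrC EFinM.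
  have m1 : measurable_fun (cell J) (fun x => (`|f x - A J| `^ p)%:E).
    by apply: (mE (fun x => `|f x - A J| `^ p)); exact: mfA.
  have m2 : measurable_fun (cell J) (fun x => (S x)%:E) by exact: (mE S).
  have m12 := emeasurable_funD m1 m2.
  have m3 : measurable_fun (cell J) (cst (t J)%:E : 'rV[R]_d -> \bar R) by [].
  have m123 := emeasurable_funD m12 m3.
  have z1 x : cell J x -> (0 <= (`|f x - A J| `^ p)%:E)%E.
    by move=> _; rewrite lee_fin powR_ge0.
  have z2 x : cell J x -> (0 <= (S x)%:E)%E by move=> Jx; rewrite lee_fin SJ.
  have z12 x : cell J x -> (0 <= (`|f x - A J| `^ p)%:E + (S x)%:E)%E.
    by move=> Jx; rewrite adde_ge0 ?z1 ?z2.
  have z3 x : cell J x ->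
      ((0 : \bar R) <= (cst (t J)%:E : 'rV[R]_d -> \bar R) x)%E.
    by move=> _; rewrite lee_fin.
  rewrite -(ge0_integralD mu mJ z1 m1 z2 m2).
  rewrite -(ge0_integralD mu mJ z12 m12 z3 m3).
  rewrite -(ge0_integralZl mu mJ m123)//; last first.
    by move=> x Jx; rewrite adde_ge0 ?z12 ?z3.
  apply: ge0_le_integral => //.
  - by apply: (mE (fun x => `|K x - f x| `^ p)).
  - exact: measurable_funeM.
  - move=> x Jx; rewrite -!EFinD -EFinM lee_fin.
    exact: operator_pointwise.
rewrite (@ge0_integral_cells R d m); last 2 first.
- exact/measurable_EFinP.
- by move=> x _; rewrite lee_fin powR_ge0.
apply: le_trans (lee_sum _ (fun J _ => cellI J)) _.
rewrite -ge0_sume_distrr; last first.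
  move=> J _; apply: adde_ge0; last by rewrite lee_fin mulr_ge0// ltW.
  apply: adde_ge0; apply: integral_ge0 => x Jx; rewrite lee_fin ?powR_ge0//.
  exact/S0/cell_unit_cube/Jx.
rewrite /operator_constant EFinM -muleA; apply: lee_wpmul2l => //.
have SE : (\int[mu]_(x in unit_cube R d) (S x)%:E =
    \sum_(J : grid) \int[mu]_(x in cell J) (S x)%:E)%E.
  apply: ge0_integral_cells; first exact/measurable_EFinP.
  by move=> x Qx; rewrite lee_fin S0.
rewrite 2!big_split/= -SE.
have O0 : (0 <= Omega)%E by exact: poweR_ge0.
have e10 : 0 <= 10 ^+ d :> R by rewrite exprn_ge0.
rewrite !EFinD !ge0_muleDl ?lee_fin ?addr_ge0 ?mulr_ge0 ?powR_ge0 ?exprn_ge0//.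
rewrite !EFinM -!muleA.
apply: leeD => //; apply: leeD => //; exact: sum_integral_dist_cell_mean_le.
Qed.

End operator_bound.

(** * Comparison with the K-functional *)

Section K_functional.
Context {R : realType} (d : nat).
Local Open Scope ereal_scope.

Lemma K_functional_ge0 (p t : R) (f : 'rV[R]_d -> R) : (0 < t)%R ->
  0 <= K_functional p f t.
Proof.
move=> t0; apply/ereal_infP => _ [gDg _ <-].
apply: adde_ge0; first exact: Lnorm_ge0.
apply: mule_ge0; first by rewrite lee_fin ltW.
by apply: sume_ge0 => i _; exact: Lnorm_ge0.
Qed.

(** The zero function is a competitor. *)
Lemma K_functional_lty (p t : R) (f : 'rV[R]_d -> R) : (1 <= p)%R ->
  f \in Lp_cube p -> K_functional p f t < +oo.
Proof.
move=> p1 fp; have p0 : (0 < p)%R := lt_le_trans ltr01 p1.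
have N0 : Lp_norm p (fun _ : 'rV[R]_d => 0%R) = 0.
  by rewrite /Lp_norm (Lnorm0 _ (p := p%:E))// eqe gt_eqF.
have Lp0 : (fun=> 0%R) \in @Lp_cube R d p.
  rewrite inE; apply/andP; split; first by rewrite inE/=; exact: measurable_cst.
  by rewrite inE/= /finite_norm [X in X < _]N0.
apply: (@le_lt_trans _ _ (Lp_norm p (fun x => f x - 0)%R +
    t%:E * \sum_(i < d) Lp_norm p (fun _ : 'rV[R]_d => 0%R))).
  apply: ereal_inf_lbound; exists (fun=> 0%R, fun=> fun=> 0%R) => //=.
  split => // i phi _.
  under eq_Rintegral do rewrite /= mul0r.
  under [in RHS]eq_Rintegral do rewrite /= mul0r.
  by rewrite Rintegral_cst ?mul0r ?oppr0//; exact: measurable_unit_cube.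
under eq_bigr do rewrite N0.
rewrite big1_eq mule0 adde0; under [X in Lp_norm _ X]eq_fun do rewrite subr0.
by move: fp; rewrite inE => /andP[_]; rewrite inE.
Qed.

End K_functional.

Lemma Lp_norm_le (R : realType) (d : nat) (p C : R) (F : 'rV[R]_d -> R)
    (Om : \bar R) :
  0 < p -> 0 <= C -> (0 <= Om)%E -> measurable_fun setT F ->
  (\int[lebesgue_rV d]_(x in unit_cube R d) (`|F x| `^ p)%:E <=
    C%:E * Om `^ p)%E ->
  (Lp_norm p F <= (C `^ p^-1)%:E * Om)%E.
Proof.
move=> p0 C0 Om0 mF H.
have pV : 0 <= p^-1 by rewrite invr_ge0 ltW.
rewrite -(@poweRe1 _ Om Om0) -(@mulfV _ p) ?gt_eqF// poweRrM -poweR_EFin.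
rewrite -poweRM ?lee_fin ?poweR_ge0//.
rewrite /Lp_norm unlock; apply: gt0_ler_poweR => //.
- rewrite in_itv/= leey andbT; apply: integral_ge0 => x _.
  by rewrite /= lee_fin powR_ge0.
- by rewrite in_itv/= leey andbT mule_ge0 ?lee_fin ?poweR_ge0.
rewrite [leLHS](_ : _ = \int[@cube_measure R d]_x (`|F x| `^ p)%:E)%E//.
rewrite ge0_integral_mrestr//.
- apply/measurable_EFinP.
  apply: (@measurableT_comp _ _ _ _ _ _ (@powR R ^~ p)) => //.
  exact: measurableT_comp.
Qed.

Theorem theorem4p3 (R : realType) (d r : nat) (p : R) :
  (0 < d)%N -> 1 <= p ->
  exists C : R, forall c1 c2 : R, modulus_K_equivalence R d p c1 c2 ->
    forall f : 'rV[R]_d -> R, f \in Lp_cube p ->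
    forall n : nat, (2 * r < n)%N ->
      (Lp_norm p (fun x => brass_stancu_kantorovich n r f x - f x)%R
       <= (c2 * C)%:E * modulus p f (n.+1%:R `^ ((2 * d)%:R^-1))^-1)%E.
Proof.
move=> d0 p1; have p0 : 0 < p := lt_le_trans ltr01 p1.
have [[e [e2 [e0 _ eK]]]|noH] :=
    pselect (exists e e2, modulus_K_equivalence R d p e e2); last first.
  (* Without any pair of constants the claim is empty. *)
  by exists 0 => c1 c2 H; case: noH; exists c1, c2.
pose B := operator_constant d r p `^ p^-1.
have B0 : 0 <= B by exact: powR_ge0.
exists (B / e) => c1 c2 [_ c20 c2K] f fp n rn.
set delta := (_ `^ _)^-1.
have de0 : 0 < delta by rewrite invr_gt0 powR_gt0.
have deE : delta ^+ (2 * d) = n.+1%:R^-1.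
  rewrite exprVn -powR_mulrn ?powR_ge0// -powRrM mulVf ?powRr1//.
  by rewrite pnatr_eq0 muln_eq0/= -lt0n.
have n0 : (0 < n)%N by rewrite (leq_trans _ rn).
have [m [m1 m2 m3 m4]] := scale_choice d0 n0 de0 deE.
have bound := operator_bound d0 p1 de0 rn fp m1 m2 m3 m4.
have K0 := K_functional_ge0 p f de0.
have Koo : K_functional p f delta \is a fin_num.
  by rewrite ge0_fin_numE// K_functional_lty.
have [eKm _] := eK _ _ fp de0; have [_ mK] := c2K _ _ fp de0.
have Om0 : (0 <= modulus p f delta)%E.
  by apply: le_trans eKm; rewrite mule_ge0// lee_fin ltW.
have mf := Lp_cube_measurable fp.
have norm_le : (Lp_norm p (fun x => brass_stancu_kantorovich n r f x - f x)%R <=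
    B%:E * modulus p f delta)%E.
  apply: Lp_norm_le => //; first exact: operator_constant_ge0.
  apply: measurable_funB => //.
  apply: measurable_sum => k; apply: measurable_funM => //.
  exact: measurable_weight.
apply: le_trans norm_le _.
(* It remains to see that [e <= c2], unless the modulus vanishes. *)
have [KE0|KN0] := eqVneq (K_functional p f delta) 0%E.
  have -> : modulus p f delta = 0%E.
    by apply/eqP; rewrite eq_le Om0 andbT (le_trans mK)// KE0 mule0.
  by rewrite !mule0.
apply: lee_wpmul2r => //; rewrite lee_fin mulrCA.
rewrite ler_peMr// ler_pdivlMr// mul1r -lee_fin.
rewrite -(@lee_pmul2r _ (K_functional p f delta))//; last by rewrite lt0e KN0.
exact: le_trans eKm mK.
Qed.
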